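(* For $\alpha\in(0,1)$ let $L_\alpha$ be the number of linearity intervals of the least concave majorant $\mathfrak{C}_\rho$ of a Poisson point process $\rho$ on $[0,1]\times(0,\infty)$ with intensity $\alpha v^{-(\alpha+1)}\,du\,dv$. Then $\mathbb{P}[L_\alpha=2]=1-\alpha$.
   Context: Write $\rho=\sum_{k=1}^\infty\delta(U_k,V_k)$. The least concave majorant of $\rho$ is $\mathfrak{C}_\rho(t)=\inf_ff(t)$, $t\in[0,1]$, where the infimum is over all concave functions $f:[0,1]\to[0,\infty)$ with $f(U_k)\ge V_k$ for all $k$. Its linearity intervals are the maximal intervals on which it is affine; for $\alpha\in(0,1)$ it is a.s. piecewise linear with finitely many of them. *)

(* Defs.v *)
From HB Require Import structures.
From mathcomp Require Import all_boot all_order all_algebra.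
From mathcomp Require Import all_classical all_reals all_analysis measurable_realfun.

Set Implicit Arguments.
Unset Strict Implicit.
Unset Printing Implicit Defensive.

Import Order.TTheory GRing.Theory Num.Theory.
Import numFieldNormedType.Exports.

Local Open Scope classical_set_scope.
Local Open Scope ring_scope.

Section poisson_point_process.
Context {R : realType} d (T : measurableType d) (P : probability T R).
Context dE (E : measurableType dE).

(* The value +oo is a possible number of points: the Poisson law with infinite
   mean is the Dirac mass at +oo.  The second argument of [poisson_prob] is
   unused by the library, and its first argument may be 0 (Dirac mass at 0). *)
Definition poisson_law (m : \bar R) (B : set (\bar R)) : \bar R :=
  if m is r%:E then poisson_prob r 0 [set n | B n%:R%:E] else (\d_(+oo : \bar R) B)%E.

Definition sum_dirac (x : nat -> E) : set E -> \bar R :=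
  mseries (fun k => \d_(x k)) 0.

Definition is_poisson_process (mu : set E -> \bar R)
    (rho : T -> set E -> \bar R) : Prop :=
  [/\ forall A, measurable A -> measurable_fun setT (fun w => rho w A),
      forall A, measurable A -> forall B : set (\bar R), measurable B ->
        P [set w | B (rho w A)] = poisson_law (mu A) B
    & forall n (A : 'I_n -> set E),
        (forall i, measurable (A i)) -> trivIset setT A ->
        forall B : 'I_n -> set (\bar R), (forall i, measurable (B i)) ->
        P [set w | forall i, B i (rho w (A i))] =
        (\prod_(i < n) P [set w | B i (rho w (A i))])%E ].

End poisson_point_process.

Section concave_majorant.
Context {R : realType}.

Definition strip : set (R * R) := `[0, 1]%classic `*` `]0, +oo[%classic.

(* The measure alpha v^-(alpha+1) du dv on the strip, extended by 0 to R^2. *)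
Definition intensity (alpha : R) (A : set (R * R)) : \bar R :=
  (\int[lebesgue_measure \x lebesgue_measure]_(p in A `&` strip)
     (alpha * p.2 `^ (- (alpha + 1)))%:E)%E.

(* A function on [0, 1] is represented by a function on R whose values outside
   [0, 1] are irrelevant. *)
Definition concave01 (f : R -> R) : Prop :=
  convex_function (`[0, 1]%classic : set R) (fun t => - f t).

Definition concave_majorants (x : nat -> R * R) : set (R -> R) :=
  [set f | [/\ concave01 f,
               forall t, 0 <= t <= 1 -> 0 <= f t
             & forall k, (x k).2 <= f (x k).1] ].

(* Equal to +oo when there is no concave majorant. *)
Definition least_concave_majorant (x : nat -> R * R) (t : R) : \bar R :=
  ereal_inf [set (f t)%:E | f in concave_majorants x].

Definition affine_on (C : R -> \bar R) (I : set R) : Prop :=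
  exists a b : R, forall t, I t -> C t = (a * t + b)%:E.

Definition affine_interval (C : R -> \bar R) (I : set R) : Prop :=
  [/\ is_interval I, I `<=` `[0, 1]%classic,
      exists s t, [/\ I s, I t & s < t] & affine_on C I].

(* Only intervals of positive length are counted: every function is affine on
   a singleton. *)
Definition linearity_interval (C : R -> \bar R) (I : set R) : Prop :=
  affine_interval C I /\
  forall J, affine_interval C J -> I `<=` J -> J = I.

Definition nb_linearity_intervals (C : R -> \bar R) : \bar R :=
  counting (linearity_interval C : set (set R)).

End concave_majorant.

(* Main.v *)
Require Import Defs.
From HB Require Import structures.
From mathcomp Require Import all_boot all_order all_algebra.
From mathcomp Require Import all_classical all_reals all_analysis measurable_realfun.
From mathcomp Require Import ring lra.

(** The majorant has exactly two linearity intervals when it is a tent: some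
    point of the process, the apex, is at least as steep as every other point
    both when seen from the foot (0, 0) and when seen from the foot (1, 0)
    ([dominating]).  The theorem is therefore a statement about the existence
    of an apex.  If m is the intensity measure, Mecke's formula gives the probability of this event as the
    integral of exp (- m (region above the tent of (u, v))) against
    m (du dv).  That region has mass v^-alpha / (1 - alpha), whatever u is
    ([intensity_low_region]), and v^-alpha is the mass s of the points of
    height above v, so that the probability is the integral of
    exp (- s / (1 - alpha)) ds over the positive half-line, which is
    1 - alpha.

    Instead of Mecke's formula, only the law of the numbers of points in
    disjoint regions is used.  In the coordinates u / v and (1 - u) / v, whose
    sum is 1 / v, the points above a tent form the region where one of the two
    coordinates is smaller than that of the apex.  The plane is cut into cells
    of mesh h in these coordinates.  An apex in a cell forces this cell to be
    hit and the region below its lower corner, where one of the coordinates is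
    smaller than that of the corner, to be void; and there is an apex in a cell
    as soon as it holds exactly one point while the rest of the region below its
    upper corner is void.  Both events have an explicit
    probability, and the two resulting sums are Riemann sums of the integral
    above, up to factors that tend to 1 with h ([dominating_probability_le],
    [dominating_probability_ge], [dominating_probability]).

    It remains to compare both events.  If there is an apex off the vertical
    sides, the majorant is the tent ([tent_nb_linearity_intervals]).
    Conversely, almost surely only finitely many points lie above any line that
    rises from a foot towards the inside, since this region has finite mass.  Under this condition the maximal slopes at both feet are
    reached, and if there is no apex, a third supporting line can be found,
    hence a third linearity interval ([no_tent_apex_nb_linearity_intervals]).

    The event that there are two linearity intervals must be measurable on the
    whole probability space, that is also on the null set where the points may
    accumulate in any way.  The number of linearity intervals is therefore
    read off the values of the majorant at rational numbers
    ([nb_linearity_intervals_eq2]), and these values are infima over rational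
    lines ([least_concave_majorant_ltP]). *)

Set Implicit Arguments.
Unset Strict Implicit.
Unset Printing Implicit Defensive.

Import Order.TTheory GRing.Theory Num.Theory.
Import numFieldNormedType.Exports.

Local Open Scope classical_set_scope.
Local Open Scope ring_scope.

(** * Concave functions on the unit interval *)

Lemma concave01P (R : realType) (f : R -> R) :
  concave01 f <-> forall a b t, 0 <= a <= 1 -> 0 <= b <= 1 -> 0 <= t <= 1 ->
    t * f a + (1 - t) * f b <= f (t * a + (1 - t) * b).
Proof.
split=> [cf a b t a01 b01 t01|cf t a b].
  have t01' : Itv.spec (@Itv.num_sem R) (Itv.Real `[0%Z, 1%Z]) t.
    by apply/and3P; split; rewrite ?num_real// bnd_simp; case/andP: t01.
  have := @cf (Itv.mk t01') a b; rewrite !inE/= !in_itv/= => /(_ a01 b01).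
  rewrite -[in X in X -> _]lerN2 convN !opprK; apply.
move=> /set_mem/=; rewrite in_itv/= => a01 /set_mem/=; rewrite in_itv/= => b01.
have t01 : 0 <= t%:num <= 1 by apply/andP; split.
rewrite -convN lerN2.
exact: cf a b t%:num a01 b01 t01.
Qed.

Lemma concave01_chord (R : realType) (f : R -> R) (a b c : R) : concave01 f ->
  0 <= a -> a < b -> b < c -> c <= 1 ->
  (c - b) * f a + (b - a) * f c <= (c - a) * f b.
Proof.
move=> /concave01P cf a0 ab bc c1.
have ac : 0 < c - a by lra.
have := cf a c ((c - b) / (c - a)).
have -> : (c - b) / (c - a) * a + (1 - (c - b) / (c - a)) * c = b.
  by field; lra.
have -> : (c - b) / (c - a) * f a + (1 - (c - b) / (c - a)) * f c =
  ((c - b) * f a + (b - a) * f c) / (c - a) by field; lra.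
move=> h; rewrite -ler_pdivrMl// mulrC; apply: h.
- by apply/andP; split; lra.
- by apply/andP; split; lra.
- by rewrite ler_pdivrMr// divr_ge0/=; lra.
Qed.

Lemma concave01_affine (R : realType) (a b : R) :
  concave01 (fun t : R => a * t + b).
Proof. by apply/concave01P => x y t _ _ _; lra. Qed.

Lemma concave01_min (R : realType) (f g : R -> R) :
  concave01 f -> concave01 g -> concave01 (fun t => Num.min (f t) (g t)).
Proof.
move=> /concave01P cf /concave01P cg; apply/concave01P => a b t a01 b01 t01.
have := cf _ _ _ a01 b01 t01; have := cg _ _ _ a01 b01 t01.
move: t01 => /andP[t0 t1] hg hf.
rewrite le_min; apply/andP; split.
- apply: le_trans hf; apply: lerD; apply: ler_wpM2l => //; try lra.
  + by rewrite ge_min lexx.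
  + by rewrite ge_min lexx.
- apply: le_trans hg; apply: lerD; apply: ler_wpM2l => //; try lra.
  + by rewrite ge_min lexx orbT.
  + by rewrite ge_min lexx orbT.
Qed.

(** A pointwise infimum of concave functions is concave, so the infimum is
    itself a majorant; nonnegativity keeps it finite. *)
Lemma least_concave_majorant_real (R : realType) (x : nat -> R * R) :
  concave_majorants x !=set0 ->
  exists c : R -> R, [/\ concave_majorants x c,
    forall t, 0 <= t <= 1 -> least_concave_majorant x t = (c t)%:E &
    forall f t, concave_majorants x f -> 0 <= t <= 1 -> c t <= f t].
Proof.
move=> [g xg].
pose S t := [set f t | f in concave_majorants x].
have S0 t : S t !=set0 by exists (g t), g.
have Slb t : 0 <= t <= 1 -> has_lbound (S t).
  by move=> t01; exists 0 => _ [f [_ f0 _] <-]; exact: f0.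
have hle f t : concave_majorants x f -> 0 <= t <= 1 -> inf (S t) <= f t.
  by move=> xf t01; apply: ge_inf; [exact: Slb|exists f].
exists (fun t => inf (S t)); split => //.
- split.
  + apply/concave01P => a b t a01 b01 t01.
    apply: lb_le_inf; first exact: S0.
    move=> _ [f xf <-]; have [/concave01P cf _ _] := xf.
    apply: le_trans (cf _ _ _ a01 b01 t01).
    by move/andP: t01 => [t0 t1]; apply: lerD; apply: ler_wpM2l; try lra;
       exact: hle.
  + by move=> t t01; apply: lb_le_inf => // _ [f [_ f0 _] <-]; exact: f0.
  + by move=> k; apply: lb_le_inf => // _ [f [_ _ fk] <-]; exact: fk.
- move=> t t01; rewrite /least_concave_majorant.
  rewrite -ereal_inf_EFin//; last exact: Slb.
  congr ereal_inf; apply/seteqP; split => [_ [f xf <-]|_ [_ [f xf <-] <-]].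
    by exists (f t) => //; exists f.
  by exists f.
Qed.

Lemma least_concave_majorantNy (R : realType) (x : nat -> R * R) (t : R) :
  concave_majorants x = set0 -> least_concave_majorant x t = +oo%E.
Proof. by move=> x0; rewrite /least_concave_majorant x0 image_set0 ereal_inf0. Qed.

(** * Linearity intervals *)

Lemma counting_eq2 (T : choiceType) (R : realType) (A : set T) :
  counting A = 2%:R%:E :> \bar R <->
  exists a b, [/\ a <> b, A a, A b & forall z, A z -> z = a \/ z = b].
Proof.
split; last first.
  move=> [a [b [/eqP ab Aa Ab Aab]]].
  have -> : A = [set a] `|` [set b].
    apply/seteqP; split => z; first by move/Aab.
    by case=> ->.
  rewrite /counting asboolT; last by rewrite finite_setU; split; exact: finite_set1.
  by rewrite fset_setU ?finite_set1// !fset_set1 finmap.cardfs2 ab.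
rewrite /counting; case: asboolP => // fA [] /eqP; rewrite eqr_nat => /eqP A2.
have inA z : A z <-> z \in finmap.enum_fset (fset_set A).
  by rewrite -[in X in X <-> _](fset_setK fA).
have := finmap.fset_uniq (fset_set A).
case E : (finmap.enum_fset (fset_set A)) A2 => [|a [|b [|]]]//= _.
rewrite inE andbT => /eqP ab; exists a, b; split => //.
- by apply/inA; rewrite E inE eqxx.
- by apply/inA; rewrite E !inE eqxx orbT.
- by move=> z /inA; rewrite E !inE => /orP[] /eqP; [left|right].
Qed.

(** A concave function lies above the chord; if it rose strictly above it at
    some point, concavity between this point and the farther end would lift
    the midpoint off the chord too. *)
Lemma concave01_midpoint_affine (R : realType) (c : R -> R) (p q : R) :
  concave01 c -> 0 <= p -> p < q -> q <= 1 ->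
  c p + c q = 2 * c ((p + q) / 2) ->
  exists a b, forall t, p <= t <= q -> c t = a * t + b.
Proof.
move=> cc p0 pq q1 cpq.
pose m := (p + q) / 2.
have mE : m = (p + q) / 2 by [].
have pm : p < m by rewrite mE; lra.
have mq : m < q by rewrite mE; lra.
have chord t u v := @concave01_chord R c t u v cc.
exists ((c q - c p) / (q - p)), (c p - (c q - c p) / (q - p) * p).
have qp0 : 0 < q - p by lra.
move=> t /andP[pt tq].
suff : (q - p) * c t = (q - t) * c p + (t - p) * c q.
  move=> h; apply: (@mulfI _ (q - p)); first by lra.
  by rewrite h; field; lra.
have [->|tp] := eqVneq t p; first by ring.
have [->|tq'] := eqVneq t q; first by ring.
have pt' : p < t by rewrite lt_neqAle eq_sym tp.
have {}tq' : t < q by rewrite lt_neqAle tq'.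
have h1 : (q - t) * c p + (t - p) * c q <= (q - p) * c t by exact: chord.
have cm : c m = (c p + c q) / 2 by rewrite cpq mE; field.
apply/eqP; rewrite eq_le h1 andbT.
have [tm|mt|->] := ltgtP t m; last by rewrite cm mE; lra.
- have := chord t m q _ tm mq q1; rewrite cm => h2.
  have {}h2 : (q - m) * c t + (m - t) * c q <= (q - t) * ((c p + c q) / 2).
    by apply: h2; lra.
  have qmE : q - m = (q - p) / 2 by rewrite mE; field.
  have mtE : m - t = (q - p) / 2 - (t - p) by rewrite mE; field.
  rewrite qmE mtE in h2; lra.
- have := chord p m t p0 pm mt; rewrite cm => h2.
  have {}h2 : (t - m) * c p + (m - p) * c t <= (t - p) * ((c p + c q) / 2).
    by apply: h2; lra.
  have qmE : m - p = (q - p) / 2 by rewrite mE; field.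
  have mtE : t - m = (t - p) - (q - p) / 2 by rewrite mE; field.
  rewrite qmE mtE in h2; lra.
Qed.

Section linearity_intervals.
Context {R : realType} (C : R -> \bar R).

(* The candidate for the linearity interval that contains p and q. *)
Let U p q := \bigcup_(J in [set J | [/\ affine_interval C J, J p & J q]]) J.

(** All affine pieces through p and q carry the same line, which is determined
    by its values at these two points. *)
Let affine_U p q J : affine_interval C J -> J p -> J q -> p < q ->
  affine_interval C (U p q).
Proof.
move=> aJ Jp Jq pq.
have UJ : J `<=` U p q by move=> t Jt; exists J.
split.
- move=> s t [J1 [[iJ1 ? ? ?] J1p J1q]] J1s [J2 [[iJ2 ? ? ?] J2p J2q]] J2t z.
  move=> /andP[sz zt].
  have [zp|pz] := leP z p.
    by exists J1 => //; apply: (iJ1 s p) => //; rewrite sz zp.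
  by exists J2 => //; apply: (iJ2 p t) => //; rewrite (ltW pz).
- by move=> t [K [[_ K01 _ _] _ _]] /K01.
- by exists p, q; split => //; exact: UJ.
- have [_ _ _ [a [b abE]]] := aJ.
  exists a, b => t [K [[_ _ _ [a' [b' abE']]] Kp Kq]] Kt.
  rewrite abE'//.
  have := abE p Jp; rewrite abE'// => -[hp].
  have := abE q Jq; rewrite abE'// => -[hq].
  have a'a : a' = a.
    have : (a' - a) * (q - p) = 0 by lra.
    by move/eqP; rewrite mulf_eq0 => /orP[] /eqP ?; lra.
  have b'b : b' = b by move: hp; rewrite a'a; lra.
  by rewrite a'a b'b.
Qed.

Lemma linearity_interval_exists J p q : affine_interval C J -> J p -> J q ->
  p < q -> exists2 I, linearity_interval C I & J `<=` I.
Proof.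
move=> aJ Jp Jq pq; exists (U p q); last by move=> t Jt; exists J.
split; first exact: affine_U aJ Jp Jq pq.
move=> K aK UK; apply/seteqP; split => // t Kt.
by exists K => //; split => //; apply: UK; exists J.
Qed.

Lemma linearity_interval_unique I K p q : linearity_interval C I ->
  linearity_interval C K -> I p -> I q -> K p -> K q -> p < q -> I = K.
Proof.
have IU J : linearity_interval C J -> J p -> J q -> p < q -> U p q = J.
  move=> [aJ mJ] Jp Jq pq; apply: mJ; first exact: affine_U aJ Jp Jq pq.
  by move=> t Jt; exists J.
by move=> lI lK Ip Iq Kp Kq pq; rewrite -(IU I)// -(IU K).
Qed.

Lemma linearity_interval_rat I : linearity_interval C I ->
  exists p q : rat, [/\ 0 < ratr p :> R, ratr p < ratr q :> R,
    ratr q < 1 :> R, I (ratr p) & I (ratr q)].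
Proof.
move=> [[iI I01 [s [t [Is It st]]] _] _].
have [p] := rat_in_itvoo st; rewrite in_itv/= => /andP[sp pt].
have [q] := rat_in_itvoo pt; rewrite in_itv/= => /andP[pq qt].
have := I01 s Is; have := I01 t It.
rewrite /= !in_itv/= => /andP[t0 t1] /andP[s0 s1].
exists p, q; split => //; try lra.
- by apply: iI Is It _ _; apply/andP; split; lra.
- by apply: iI Is It _ _; apply/andP; split; lra.
Qed.

End linearity_intervals.

(** For a concave function, affinity at the midpoint is affinity on the whole
    segment.  Segments stay away from 0 and 1, where a concave function may
    jump. *)
Definition rat_affine (R : realType) (c : R -> R) (p q : rat) : Prop :=
  [/\ 0 < ratr p :> R, ratr p < ratr q :> R, ratr q < 1 :> R &
     c (ratr p) + c (ratr q) = 2 * c ((ratr p + ratr q) / 2)].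

(** Linearity intervals are identified with classes of rational segments on
    which the function is affine: every linearity interval contains such a
    segment, and two segments belong to the same interval exactly when the
    function is affine on their hull. *)
Section rational_characterisation.
Context {R : realType} (C : R -> \bar R) (c : R -> R).
Hypothesis cc : concave01 c.
Hypothesis CE : forall t, 0 <= t <= 1 -> C t = (c t)%:E.

Lemma rat_affine_linearity_interval p q : rat_affine c p q ->
  exists I, [/\ linearity_interval C I, I (ratr p) & I (ratr q)].
Proof.
move=> [p0 pq q1 cpq].
have [a [b abE]] := concave01_midpoint_affine cc (ltW p0) pq (ltW q1) cpq.
have aJ : affine_interval C `[ratr p, ratr q].
  split.
  - exact: interval_is_interval.
  - by move=> t; rewrite /= !in_itv/= => /andP[? ?]; apply/andP; split; lra.
  - exists (ratr p), (ratr q); rewrite /= !in_itv/= !lexx (ltW pq); by split.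
  - exists a, b => t; rewrite /= in_itv/= => tpq; rewrite CE ?abE//.
    by move/andP: tpq => [? ?]; apply/andP; split; lra.
have Jp : `[ratr p, ratr q]%classic (ratr p : R).
  by rewrite /= in_itv/= lexx ltW.
have Jq : `[ratr p, ratr q]%classic (ratr q : R).
  by rewrite /= in_itv/= lexx ltW.
have [I lI JI] := linearity_interval_exists aJ Jp Jq pq.
by exists I; split => //; exact: JI.
Qed.

Lemma linearity_interval_rat_affine I p q : linearity_interval C I ->
  0 < ratr p :> R -> ratr p < ratr q :> R -> ratr q < 1 :> R ->
  I (ratr p) -> I (ratr q) -> rat_affine c p q.
Proof.
move=> [[iI I01 _ [a [b abE]]] _] p0 pq q1 Ip Iq; split => //.
have Im : I ((ratr p + ratr q) / 2).
  by apply: iI Ip Iq _ _; apply/andP; split; lra.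
have E t : I t -> c t = a * t + b.
  move=> It; have := abE t It; rewrite CE; first by case.
  by have := I01 t It; rewrite /= in_itv.
by rewrite !E//; field.
Qed.

Lemma nb_linearity_intervals_eq2 :
  nb_linearity_intervals C = 2%:R%:E <->
  exists p q p' q' : rat, [/\ rat_affine c p q, rat_affine c p' q',
    ~ rat_affine c (Order.min p p') (Order.max q q') &
    forall r s, rat_affine c r s ->
      rat_affine c (Order.min p r) (Order.max q s) \/
      rat_affine c (Order.min p' r) (Order.max q' s)].
Proof.
have hull p q r s I : rat_affine c p q -> rat_affine c r s ->
    linearity_interval C I -> I (ratr p) -> I (ratr q) -> I (ratr r) ->
    I (ratr s) -> rat_affine c (Order.min p r) (Order.max q s).
  move=> [p0 pq q1 _] [r0 rs s1 _] lI Ip Iq Ir Is.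
  apply: (linearity_interval_rat_affine lI); rewrite /Order.min /Order.max;
    case: (ltP p r) => h1; case: (ltP q s) => h2; rewrite //;
    move: h1 h2; rewrite -?(ler_rat R) -?(ltr_rat R); lra.
have hullI p q r s : rat_affine c p q -> rat_affine c r s ->
    rat_affine c (Order.min p r) (Order.max q s) ->
    exists I, [/\ linearity_interval C I, I (ratr p), I (ratr q), I (ratr r)
      & I (ratr s)].
  move=> [p0 pq q1 _] [r0 rs s1 _] /rat_affine_linearity_interval[I [lI Ia Ib]].
  have [[iI _ _ _] _] := lI.
  have min1 : ratr (Order.min p r) <= ratr p :> R by rewrite ler_rat ge_min lexx.
  have min2 : ratr (Order.min p r) <= ratr r :> R.
    by rewrite ler_rat ge_min lexx orbT.
  have max1 : ratr q <= ratr (Order.max q s) :> R by rewrite ler_rat le_max lexx.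
  have max2 : ratr s <= ratr (Order.max q s) :> R.
    by rewrite ler_rat le_max lexx orbT.
  by exists I; split => //; apply: iI Ia Ib _ _; apply/andP; split; lra.
rewrite counting_eq2; split.
- move=> [I [J [IJ lI lJ onlyIJ]]].
  have [p [q [p0 pq q1 Ip Iq]]] := linearity_interval_rat lI.
  have [p' [q' [p'0 pq' q'1 Jp' Jq']]] := linearity_interval_rat lJ.
  have apq : rat_affine c p q by exact: linearity_interval_rat_affine lI _ _ _ _ _.
  have apq' : rat_affine c p' q'.
    exact: linearity_interval_rat_affine lJ _ _ _ _ _.
  exists p, q, p', q'; split => //.
  + move=> /(hullI _ _ _ _ apq apq')[K [lK Kp Kq Kp' Kq']]; apply: IJ.
    rewrite (linearity_interval_unique lI lK Ip Iq Kp Kq pq).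
    by rewrite (linearity_interval_unique lJ lK Jp' Jq' Kp' Kq' pq').
  + move=> r s ars; have [K [lK Kr Ks]] := rat_affine_linearity_interval ars.
    have [KE|KE] := onlyIJ K lK; rewrite KE in Kr Ks; [left|right].
      exact: hull apq ars lI Ip Iq Kr Ks.
    exact: hull apq' ars lJ Jp' Jq' Kr Ks.
- move=> [p [q [p' [q' [apq apq' nhull honly]]]]].
  have [I [lI Ip Iq]] := rat_affine_linearity_interval apq.
  have [J [lJ Jp' Jq']] := rat_affine_linearity_interval apq'.
  have [[_ pq _ _] [_ pq' _ _]] := (apq, apq').
  exists I, J; split => //.
  + move=> IJ; apply: nhull; rewrite -IJ in Jp' Jq'.
    exact: hull apq apq' lI Ip Iq Jp' Jq'.
  + move=> K lK.
    have [r [s [r0 rs s1 Kr Ks]]] := linearity_interval_rat lK.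
    have ars : rat_affine c r s.
      exact: linearity_interval_rat_affine lK _ _ _ _ _.
    have [h|h] := honly r s ars; [left|right].
      have [M [lM Mp Mq Mr Ms]] := hullI _ _ _ _ apq ars h.
      rewrite (linearity_interval_unique lK lM Kr Ks Mr Ms rs).
      by rewrite (linearity_interval_unique lI lM Ip Iq Mp Mq pq).
    have [M [lM Mp Mq Mr Ms]] := hullI _ _ _ _ apq' ars h.
    rewrite (linearity_interval_unique lK lM Kr Ks Mr Ms rs).
    by rewrite (linearity_interval_unique lJ lM Jp' Jq' Mp Mq pq').
Qed.

End rational_characterisation.

(** * Tents and supporting lines *)

(** Seen from each of the two feet (0, 0) and (1, 0), the point [x k] has the
    steepest slope: no point lies above the tent that joins it to the feet. *)
Definition dominating (R : realType) (x : nat -> R * R) (k : nat) : Prop :=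
  forall l, (x l).2 * (x k).1 <= (x k).2 * (x l).1 /\
            (x l).2 * (1 - (x k).1) <= (x k).2 * (1 - (x l).1).

Definition tent_apex (R : realType) (x : nat -> R * R) (k : nat) : Prop :=
  0 < (x k).1 < 1 /\ dominating x k.

Lemma affine_concave_majorant (R : realType) (x : nat -> R * R) (a b : R) :
  0 <= b -> 0 <= a + b -> (forall k, (x k).2 <= a * (x k).1 + b) ->
  concave_majorants x (fun t => a * t + b).
Proof.
move=> b0 ab0 xab; split => //; first exact: concave01_affine.
move=> t /andP[t0 t1].
have -> : a * t + b = (1 - t) * b + t * (a + b) by ring.
by rewrite addr_ge0// mulr_ge0// subr_ge0.
Qed.

Section tent.
Context {R : realType} (x : nat -> R * R) (k : nat).
Hypothesis xstrip : forall l, strip (x l).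
Hypothesis xk : tent_apex x k.

Let u := (x k).1.
Let v := (x k).2.

Let v0 : 0 < v.
Proof. by have [_] := xstrip k; rewrite /= in_itv/= andbT. Qed.

Let u01 : 0 < u /\ u < 1. Proof. by have [/andP] := xk. Qed.

Let tent t := Num.min (v / u * t + 0) (- (v / (1 - u)) * t + v / (1 - u)).

Let tent_majorant : concave_majorants x tent.
Proof.
have [u0 u1] := u01.
have u1' : 0 < 1 - u by lra.
split; first by apply: concave01_min; exact: concave01_affine.
- move=> t /andP[t0 t1]; rewrite le_min; apply/andP; split.
    by rewrite addr0 mulr_ge0// divr_ge0// ltW.
  have -> : - (v / (1 - u)) * t + v / (1 - u) = v / (1 - u) * (1 - t) by ring.
  by rewrite mulr_ge0 ?divr_ge0 ?subr_ge0// ltW.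
- move=> l; have [_ /(_ l)[h1 h2]] := xk; rewrite le_min; apply/andP; split.
    by rewrite addr0 mulrAC ler_pdivlMr.
  have -> : - (v / (1 - u)) * (x l).1 + v / (1 - u) = v * (1 - (x l).1) / (1 - u).
    by ring.
  by rewrite ler_pdivlMr.
Qed.

(** The tent is a concave majorant, and any concave majorant is at least 0 at
    the feet and at least [v] at [u], hence above the tent. *)
Lemma tent_least_concave_majorant t : 0 <= t <= 1 ->
  least_concave_majorant x t =
  (if t <= u then v / u * t else v / (1 - u) * (1 - t))%:E.
Proof.
have [u0 u1] := u01.
have u1' : 0 < 1 - u by lra.
have [c [[cc c0 cx] CE cle]] := @least_concave_majorant_real R x
  (ex_intro _ _ tent_majorant).
move=> t01; rewrite CE//; congr EFin.
have := cle _ _ tent_majorant t01.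
rewrite /tent le_min addr0 => /andP[h1].
have -> : - (v / (1 - u)) * t + v / (1 - u) = v / (1 - u) * (1 - t) by ring.
move=> h2; move: t01 => /andP[t0 t1].
have cu : v <= c u := cx k.
case: leP => tu; apply/eqP; rewrite eq_le ?h1 ?h2/=.
- have [<-|t0'] := eqVneq 0 t; first by rewrite mulr0 c0// lexx ler01.
  have [->|tu'] := eqVneq t u; first by rewrite divfK// gt_eqF.
  have := concave01_chord cc (lexx 0) _ _ (ltW u1); rewrite !subr0.
  move=> /(_ t); rewrite !lt_neqAle t0' t0 tu' tu => /(_ isT isT) h.
  have c00 : 0 <= (u - t) * c 0 by rewrite mulr_ge0 ?c0 ?lexx ?ler01 ?subr_ge0.
  rewrite mulrAC ler_pdivrMr// [c t * u]mulrC; apply: le_trans h.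
  apply: (@le_trans _ _ (t * c u)); last by lra.
  by rewrite mulrC ler_wpM2l.
- have [->|t1'] := eqVneq t 1; first by rewrite subrr mulr0 c0// lexx ler01.
  have t1'' : t < 1 by rewrite lt_neqAle t1' t1.
  have h := concave01_chord cc (ltW u0) tu t1'' (lexx 1).
  have c10 : 0 <= (t - u) * c 1 by rewrite mulr_ge0 ?c0 ?lexx ?ler01 ?subr_ge0 ?ltW.
  rewrite mulrAC ler_pdivrMr// [c t * _]mulrC; apply: le_trans h.
  apply: (@le_trans _ _ ((1 - t) * c u)); last by lra.
  by rewrite mulrC ler_wpM2l// subr_ge0.
Qed.

(** The slope changes sign at the apex, so no affine piece crosses it. *)
Lemma tent_nb_linearity_intervals :
  nb_linearity_intervals (least_concave_majorant x) = 2%:R%:E.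
Proof.
have [u0 u1] := u01.
have u1' : 0 < 1 - u by lra.
have sides J : affine_interval (least_concave_majorant x) J ->
    J `<=` `[0, u] \/ J `<=` `[u, 1].
  move=> [iJ J01 _ [a [b abE]]].
  have J01' t : J t -> 0 <= t <= 1 by move=> /J01; rewrite /= in_itv.
  apply: contrapT => /not_orP[/existsNP[t /not_implyP[Jt tu]]].
  move=> /existsNP[s /not_implyP[Js su]].
  have {}tu : u < t.
    rewrite ltNge; apply/negP => h; apply: tu.
    by rewrite /= in_itv/= h andbT; case/andP: (J01' _ Jt).
  have {}su : s < u.
    rewrite ltNge; apply/negP => h; apply: su.
    by rewrite /= in_itv/= h /=; case/andP: (J01' _ Js).
  have Ju : J u by apply: iJ Js Jt _ _; rewrite !ltW.
  have := abE s Js; rewrite tent_least_concave_majorant ?J01'// (ltW su) => -[Es].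
  have := abE u Ju; rewrite tent_least_concave_majorant ?J01'// lexx => -[Eu].
  have := abE t Jt; rewrite tent_least_concave_majorant ?J01'// leNgt tu => -[Et].
  have avu : a = v / u.
    apply: (@mulIf _ (u - s)); first by lra.
    by rewrite 2!mulrBr Es; lra.
  have Eu' : v = a * u + b by rewrite -Eu divfK// gt_eqF.
  have avu' : a = - (v / (1 - u)).
    apply: (@mulIf _ (t - u)); first by lra.
    have -> : - (v / (1 - u)) * (t - u) = v / (1 - u) * (1 - t) - v.
      by field; lra.
    by rewrite Et [X in _ = _ - X]Eu'; ring.
  have : 0 < v / u by rewrite divr_gt0.
  have : 0 < v / (1 - u) by rewrite divr_gt0.
  lra.
have aI : affine_interval (least_concave_majorant x) `[0, u].
  split; first exact: interval_is_interval.
  - by move=> t; rewrite /= !in_itv/= => /andP[? ?]; apply/andP; split; lra.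
  - exists 0, u; rewrite /= !in_itv/= !lexx ltW//; by split.
  - exists (v / u), 0 => t; rewrite /= in_itv/= => /andP[t0 tu].
    by rewrite tent_least_concave_majorant ?tu ?addr0//; apply/andP; split; lra.
have aJ : affine_interval (least_concave_majorant x) `[u, 1].
  split; first exact: interval_is_interval.
  - by move=> t; rewrite /= !in_itv/= => /andP[? ?]; apply/andP; split; lra.
  - exists u, 1; rewrite /= !in_itv/= !lexx (ltW u1)//; by split.
  - exists (- (v / (1 - u))), (v / (1 - u)) => t; rewrite /= in_itv/= => /andP[ut t1].
    rewrite tent_least_concave_majorant; last by apply/andP; split; lra.
    case: leP => tu; congr EFin; last by ring.
    have -> : t = u by lra.
    by field; lra.
apply/counting_eq2; exists `[0, u]%classic, `[u, 1]%classic; split.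
- move=> E; have : `[u, 1]%classic (0 : R) by rewrite -E /= in_itv/= lexx ltW.
  by rewrite /= in_itv/= => /andP[]; lra.
- split => // K aK IK; apply/seteqP; split => //.
  have [//|Ku1] := sides K aK.
  have : `[u, 1]%classic (0 : R) by apply/Ku1/IK; rewrite /= in_itv/= lexx ltW.
  by rewrite /= in_itv/= => /andP[]; lra.
- split => // K aK IK; apply/seteqP; split => //.
  have [K0u|//] := sides K aK.
  have : `[0, u]%classic (1 : R) by apply/K0u/IK; rewrite /= in_itv/= lexx ltW.
  by rewrite /= in_itv/= => /andP[]; lra.
- move=> K [aK mK]; have [h|h] := sides K aK; [left|right].
    by rewrite (mK `[0, u]%classic).
  by rewrite (mK `[u, 1]%classic).
Qed.

End tent.

Section three_lines.
Context {R : realType} (C : R -> \bar R) (c : R -> R).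
Hypothesis cc : concave01 c.
Hypothesis CE : forall t, 0 <= t <= 1 -> C t = (c t)%:E.

(** The line of slope [a] and intercept [b] carries an edge of the graph: by
    concavity a line above the graph that touches it twice coincides with it in
    between. *)
Definition face (a b : R) : Prop :=
  (forall t, 0 <= t <= 1 -> c t <= a * t + b) /\
  exists s t, [/\ 0 <= s, s < t, t <= 1, a * s + b <= c s & a * t + b <= c t].

Lemma face_linearity_interval a b : face a b ->
  exists I, linearity_interval C I /\ forall t, I t -> C t = (a * t + b)%:E.
Proof.
move=> [cab [s [t [s0 st t1 cs ct]]]].
have cabE z : s <= z <= t -> c z = a * z + b.
  move=> /andP[sz zt]; apply/eqP; rewrite eq_le cab/=; last first.
    by apply/andP; split; lra.
  have [->//|sz'] := eqVneq z s; have [->//|zt'] := eqVneq z t.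
  have sz'' : s < z by rewrite lt_neqAle eq_sym sz'.
  have zt'' : z < t by rewrite lt_neqAle zt'.
  have h := concave01_chord cc s0 sz'' zt'' t1.
  rewrite -(ler_pM2l (_ : 0 < t - s)); last by lra.
  apply: le_trans h.
  have h1 : (t - z) * (a * s + b) <= (t - z) * c s by rewrite ler_wpM2l; lra.
  have h2 : (z - s) * (a * t + b) <= (z - s) * c t by rewrite ler_wpM2l; lra.
  have -> : (t - s) * (a * z + b) = (t - z) * (a * s + b) + (z - s) * (a * t + b).
    by ring.
  lra.
have aJ : affine_interval C `[s, t].
  split; first exact: interval_is_interval.
  - by move=> z; rewrite /= !in_itv/= => /andP[? ?]; apply/andP; split; lra.
  - exists s, t; rewrite /= !in_itv/= !lexx (ltW st)//; by split.
  - exists a, b => z; rewrite /= in_itv/= => szt; rewrite CE ?cabE//.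
    by move/andP: szt => [? ?]; apply/andP; split; lra.
have Js : `[s, t]%classic s by rewrite /= in_itv/= lexx ltW.
have Jt : `[s, t]%classic t by rewrite /= in_itv/= lexx ltW.
have [I lI JI] := linearity_interval_exists aJ Js Jt st.
exists I; split => //; have [[_ I01 _ [a' [b' abE]]] _] := lI.
have := abE s (JI _ Js); rewrite CE ?cabE ?lexx ?(ltW st)//; last first.
  by apply/andP; split; lra.
move=> -[Es].
have := abE t (JI _ Jt); rewrite CE ?cabE ?lexx ?(ltW st)//; last first.
  by apply/andP; split; lra.
move=> -[Et].
have aa : a = a' by apply: (@mulIf _ (t - s)); lra.
have bb : b = b' by rewrite aa in Es; lra.
by rewrite aa bb.
Qed.

Lemma three_faces a1 b1 a2 b2 a3 b3 : face a1 b1 -> face a2 b2 -> face a3 b3 ->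
  (a1, b1) <> (a2, b2) -> (a1, b1) <> (a3, b3) -> (a2, b2) <> (a3, b3) ->
  nb_linearity_intervals C <> 2%:R%:E.
Proof.
move=> /face_linearity_interval[I1 [lI1 E1]] /face_linearity_interval[I2 [lI2 E2]].
move=> /face_linearity_interval[I3 [lI3 E3]].
have same I J a b a' b' : linearity_interval C I -> I = J ->
    (forall t, I t -> C t = (a * t + b)%:E) ->
    (forall t, J t -> C t = (a' * t + b')%:E) -> (a, b) = (a', b').
  move=> [[_ _ [s [t [Is It st]]] _] _] <- E E'.
  have := E s Is; rewrite E'// => -[hs].
  have := E t It; rewrite E'// => -[ht].
  have aa : a = a' by apply: (@mulIf _ (t - s)); lra.
  have bb : b = b' by rewrite aa in hs; lra.
  by rewrite aa bb.
move=> n12 n13 n23 /counting_eq2[I [J [IJ lI lJ only]]].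
have h12 : I1 <> I2 by move=> h; exact/n12/(same _ _ _ _ _ _ lI1 h E1 E2).
have h13 : I1 <> I3 by move=> h; exact/n13/(same _ _ _ _ _ _ lI1 h E1 E3).
have h23 : I2 <> I3 by move=> h; exact/n23/(same _ _ _ _ _ _ lI2 h E2 E3).
by case: (only _ lI1) (only _ lI2) (only _ lI3) => [h1|h1] [h2|h2] [h3|h3];
  congruence.
Qed.

End three_lines.

(** * Configurations without a tent *)

Lemma finite_argmax (R : realType) (A : set nat) (f : nat -> R) :
  finite_set A -> A !=set0 -> exists2 k, A k & forall l, A l -> f l <= f k.
Proof.
move=> /finite_seqP[s ->] {A}; elim: s => [[k]//|k s ih _].
have [s0|/set0P s0] := eqVneq [set` s] set0.
  exists k => [|l]; rewrite /= ?mem_head// inE => /orP[/eqP->//|sl].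
  by have : [set` s] l by []; rewrite s0.
have [m /= ms mmax] := ih s0.
have [km|mk] := leP (f k) (f m).
  exists m => [|l]; rewrite /= ?inE ?ms ?orbT// => /orP[/eqP->//|]; exact: mmax.
exists k => [|l]; rewrite /= ?mem_head// inE => /orP[/eqP->//|/mmax lm].
exact: le_trans lm (ltW mk).
Qed.

(** With [w] the horizontal distance to a foot, [v k / w k] is the slope seen
    from this foot.  Only finitely many slopes exceed a given positive value,
    so the largest one is reached; among the points that reach it, the
    farthest one is taken. *)
Lemma steepest_point (R : realType) (w v : nat -> R) :
  (forall k, 0 < w k) -> (forall k, 0 < v k) ->
  (forall n : nat, finite_set [set k | w k < n%:R * v k]) ->
  exists k, forall l, v l * w k <= v k * w l /\
    (v l * w k = v k * w l -> w l <= w k).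
Proof.
move=> w0 v0 fwv.
have [n nE] : exists n : nat, w 0%N < n%:R * v 0%N.
  exists (Num.Def.archi_bound (w 0%N / v 0%N)).
  by rewrite -ltr_pdivrMr// archi_boundP// divr_ge0// ltW.
have [k1 /= k1A k1max] := finite_argmax (fun k => v k / w k) (fwv n)
  (ex_intro _ 0%N nE).
have ratio l k : (v l / w l <= v k / w k) = (v l * w k <= v k * w l).
  by rewrite ler_pdivrMr// mulrAC ler_pdivlMr.
have ratio_eq l k : v l / w l = v k / w k <-> v l * w k = v k * w l.
  split=> h.
    by rewrite -(divfK (lt0r_neq0 (w0 l)) (v l)) h; field; rewrite lt0r_neq0.
  apply: (@mulIf _ (w l * w k)); first by rewrite mulf_neq0// lt0r_neq0.
  have -> : v l / w l * (w l * w k) = v l * w k by field; rewrite lt0r_neq0.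
  by rewrite h; field; rewrite lt0r_neq0.
have out l : ~ w l < n%:R * v l -> v l / w l < v k1 / w k1.
  move/negP; rewrite -leNgt => nl.
  apply: lt_le_trans (k1max 0%N nE).
  rewrite ltr_pdivrMr// mulrAC ltr_pdivlMr//.
  have n0 : 0 < n%:R :> R.
    by rewrite -(pmulr_lgt0 _ (v0 0%N)); exact: lt_trans (w0 _) nE.
  rewrite -(ltr_pM2l n0) !mulrA; apply: (@le_lt_trans _ _ (w l * w 0%N)).
    by rewrite ler_pM2r.
  by rewrite [ltRHS]mulrC ltr_pM2l.
have k1glob l : v l / w l <= v k1 / w k1.
  by have [/k1max//|/out/ltW] := pselect (w l < n%:R * v l).
pose B := [set k | w k < n%:R * v k] `&` [set k | v k / w k = v k1 / w k1].
have [k /= [kA kk1] kmax] : exists2 k, B k & forall l, B l -> w l <= w k.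
  apply: finite_argmax; last by exists k1.
  by apply: sub_finite_set (fwv n) => l [].
exists k => l; split; first by rewrite -ratio kk1.
move=> /ratio_eq lk; apply: kmax; split => /=; last by rewrite lk.
by apply: contrapT => /out; rewrite lk kk1 ltxx.
Qed.

(** Let [x k] be the steepest point seen from (0, 0), the farthest one in case
    of a tie.  Since it is not an apex, some points lie above the line from
    [x k] to (1, 0); they are on the right of [x k] and finitely many, so one
    of them, [x m], is the steepest seen from [x k].  The line through [x k]
    and [x m] is above all the points, and is positive at both feet: at 0
    because the tie was broken by distance, at 1 because [x m] is above the
    line to (1, 0).  It thus differs from the two edges through the feet. *)
Lemma no_tent_apex_nb_linearity_intervals (R : realType) (x : nat -> R * R) :
  (forall k, strip (x k)) -> (forall k, 0 < (x k).1 < 1) ->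
  (forall n : nat, finite_set [set k | (x k).1 < n%:R * (x k).2]) ->
  (forall n : nat, finite_set [set k | 1 - (x k).1 < n%:R * (x k).2]) ->
  ~ (exists k, tent_apex x k) ->
  nb_linearity_intervals (least_concave_majorant x) <> 2%:R%:E.
Proof.
move=> xstrip x01 fin0 fin1 napex.
have v0 k : 0 < (x k).2 by have [_] := xstrip k; rewrite /= in_itv/= andbT.
have u0 k : 0 < (x k).1 by have /andP[] := x01 k.
have u1 k : 0 < 1 - (x k).1 by rewrite subr_gt0; have /andP[] := x01 k.
have [x0|/set0P xne] := eqVneq (concave_majorants x) set0.
  move=> /counting_eq2[I [_ [_ [[_ _ [s [_ [Is _ _]]] [a [b abE]]] _] _ _]]].
  by have := abE s Is; rewrite least_concave_majorantNy.
have [c [[cc c0 cx] CE cle]] := least_concave_majorant_real xne.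
have [k kmax] := steepest_point u0 v0 fin0.
have [k3 k3max] := steepest_point u1 v0 fin1.
pose u := (x k).1; pose v := (x k).2.
have u0k : 0 < u by exact: u0.
have u1k : 0 < 1 - u by exact: u1.
have v0k : 0 < v by exact: v0.
have lineE a l : - a * (x l).1 + a = a * (1 - (x l).1) by ring.
pose D := [set l | v * (1 - (x l).1) < (x l).2 * (1 - u)].
have Dgt l : D l -> u < (x l).1.
  rewrite /D/= => h; rewrite ltNge; apply/negP => lu.
  move: h; apply/negP; rewrite -leNgt.
  have [h _] := kmax l.
  rewrite -(ler_pM2r u0k) -mulrA [(1 - u) * u]mulrC mulrA.
  apply: (@le_trans _ _ (v * (x l).1 * (1 - u))).
    by rewrite ler_pM2r.
  rewrite -!mulrA ler_pM2l//; lra.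
have D0 : D !=set0.
  apply: contrapT => nD; apply: napex; exists k; split => // l; split.
    by case: (kmax l).
  by rewrite leNgt; apply/negP => h; apply: nD; exists l.
have finD : finite_set D.
  have [n nE] : exists n : nat, (1 - u) / v < n%:R.
    exists (Num.Def.archi_bound ((1 - u) / v)).
    by rewrite archi_boundP// divr_ge0// ltW.
  apply: sub_finite_set (fin1 n) => l; rewrite /D/= => h.
  apply: (@lt_trans _ _ ((1 - u) / v * (x l).2)).
    by rewrite mulrAC ltr_pdivlMr// mulrC [(1 - u) * _]mulrC.
  by rewrite ltr_pM2r.
have [m Dm mmax] := finite_argmax (fun l => ((x l).2 - v) / ((x l).1 - u)) finD D0.
have um := Dgt _ Dm.
have um0 : 0 < (x m).1 - u by lra.
pose a := ((x m).2 - v) / ((x m).1 - u).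
have aE : a * ((x m).1 - u) = (x m).2 - v by rewrite /a divfK ?lt0r_neq0.
have b0 : a * u < v.
  have : (x m).2 * u < v * (x m).1.
    have [h1 h2] := kmax m; rewrite lt_neqAle h1 andbT; apply/eqP => /h2.
    by rewrite leNgt um.
  by move=> h; rewrite -(ltr_pM2r um0) mulrAC aE; lra.
have b1 : - v < a * (1 - u).
  rewrite -(ltr_pM2r um0) [a * _ * _]mulrAC aE.
  move: Dm; rewrite /D/=; lra.
have amaj l : (x l).2 <= a * (x l).1 + (v - a * u).
  have -> : a * (x l).1 + (v - a * u) = a * ((x l).1 - u) + v by ring.
  rewrite -lerBlDr.
  have [Dl|] := pselect (D l).
    by rewrite -ler_pdivrMr ?subr_gt0 ?Dgt//; exact: mmax.
  rewrite /D/= => /negP; rewrite -leNgt => Dl.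
  have [lu|ul] := leP (x l).1 u.
    have [h _] := kmax l; rewrite -(ler_pM2r u0k).
    have : 0 <= (v - a * u) * (u - (x l).1) by rewrite mulr_ge0// subr_ge0// ltW.
    move: h; rewrite -/u -/v; lra.
  rewrite -(ler_pM2r u1k).
  have : 0 <= (a * (1 - u) + v) * ((x l).1 - u).
    by rewrite mulr_ge0// ?subr_ge0 1?ltW//; lra.
  lra.
have facePn a' b' s t : concave_majorants x (fun z => a' * z + b') ->
    0 <= s -> s < t -> t <= 1 -> a' * s + b' <= c s -> a' * t + b' <= c t ->
    face c a' b'.
  move=> maj s0 st t1 hs ht; split; last by exists s, t.
  by move=> z z01; exact: cle maj z01.
have f1 : face c (v / u) 0.
  apply: (@facePn _ _ 0 u) => //; rewrite ?mulr0 ?addr0 ?c0 ?lexx ?ler01//.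
  - apply: affine_concave_majorant => //.
      by rewrite addr0 divr_ge0 ?ltW.
    move=> l; rewrite addr0 mulrAC ler_pdivlMr//; by case: (kmax l).
  - lra.
  - by rewrite divfK ?lt0r_neq0// cx.
have f2 : face c a (v - a * u).
  apply: (@facePn _ _ u (x m).1) => //; last 3 first.
  - have := u1 m; lra.
  - by rewrite addrCA subrr addr0; exact: cx.
  - have -> : a * (x m).1 + (v - a * u) = a * ((x m).1 - u) + v by ring.
    by rewrite aE subrK.
  - by apply: affine_concave_majorant => //; lra.
  - lra.
pose w3 := (x k3).2 / (1 - (x k3).1).
have w30 : 0 < w3 by rewrite divr_gt0.
have f3 : face c (- w3) w3.
  apply: (@facePn _ _ (x k3).1 1) => //.
  - apply: affine_concave_majorant; [lra|lra|] => l.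
    rewrite lineE mulrAC ler_pdivlMr//; by case: (k3max l).
  - by rewrite ltW.
  - by have := u1 k3; lra.
  - by rewrite lineE /w3 divfK ?lt0r_neq0.
  - by rewrite mulr1 addNr c0// lexx ler01.
apply: (three_faces cc CE f1 f2 f3).
- by case=> _ h; move: b0; lra.
- by case=> _ h; move: w30; rewrite -h ltxx.
- by case=> h1; rewrite h1 => h2; move: b1; rewrite h1; lra.
Qed.

(** * Measurability of the number of linearity intervals *)

Lemma concave01_supporting_line (R : realType) (f : R -> R) (t : R) :
  concave01 f -> 0 < t < 1 ->
  exists a, forall s, 0 <= s <= 1 -> f s <= f t + a * (s - t).
Proof.
move=> cf /andP[t0 t1].
pose S := [set (f s - f t) / (s - t) | s in [set s | t < s <= 1]].
have slope r s : 0 <= r < t -> t < s <= 1 ->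
    (f s - f t) / (s - t) <= (f t - f r) / (t - r).
  move=> /andP[r0 rt] /andP[ts s1].
  have h := concave01_chord cf r0 rt ts s1.
  rewrite ler_pdivrMr ?subr_gt0// mulrAC ler_pdivlMr ?subr_gt0//; lra.
have Sub r : 0 <= r < t -> ubound S ((f t - f r) / (t - r)).
  by move=> rt _ [s st <-]; exact: slope.
have S1 : S ((f 1 - f t) / (1 - t)) by exists 1 => //=; rewrite t1 lexx.
exists (sup S) => s /andP[s0 s1]; rewrite -lerBlDl.
have [st|ts|->] := ltgtP s t; last by rewrite !subrr mulr0.
- have h : sup S <= (f t - f s) / (t - s).
    by apply: ge_sup; [exists ((f 1 - f t) / (1 - t))|apply: Sub; rewrite s0].
  rewrite ler_pdivlMr ?subr_gt0// in h; lra.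
- rewrite -ler_pdivrMr ?subr_gt0//; apply: sup_upper_bound.
    split; first by exists ((f 1 - f t) / (1 - t)).
    by exists ((f t - f 0) / (t - 0)); apply: Sub; rewrite lexx.
  by exists s => //=; rewrite ts.
Qed.

Definition rat_line_above (R : realType) (x : nat -> R * R) (a b : rat) : Prop :=
  [/\ 0 <= ratr b :> R, 0 <= ratr a + ratr b :> R &
     forall k, (x k).2 <= ratr a * (x k).1 + ratr b].

(** A supporting line of a majorant at the interior point [t] is itself above
    all the points; raising slope and intercept slightly makes them rational.
    There may be no supporting line at 0 and 1. *)
Lemma least_concave_majorant_ltP (R : realType) (x : nat -> R * R) (t r : R) :
  (forall k, 0 <= (x k).1 <= 1) -> 0 < t < 1 ->
  (least_concave_majorant x t < r%:E)%E <->
  exists a b, rat_line_above x a b /\ ratr a * t + ratr b < r.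
Proof.
move=> x01 t01; have /andP[t0 t1] := t01; split; last first.
  move=> [a [b [[b0 ab0 xab] abr]]].
  apply: (@le_lt_trans _ _ (ratr a * t + ratr b)%:E); last by rewrite lte_fin.
  apply: ereal_inf_lbound; exists (fun s => ratr a * s + ratr b) => //.
  exact: affine_concave_majorant.
move=> /ereal_inf_lt[_ [f [cf f0 xf] <-]]; rewrite lte_fin => ftr.
have [a' fa] := concave01_supporting_line cf t01.
(* half of the room for the slope, half for the intercept *)
pose e := (r - f t) / 2.
have e0 : 0 < e by rewrite divr_gt0// subr_gt0.
have /rat_in_itvoo[a] : a' < a' + e by rewrite ltrDl.
rewrite in_itv/= => /andP[aa ae].
have /rat_in_itvoo[b] : f t - a' * t < f t - a' * t + e by rewrite ltrDl.
rewrite in_itv/= => /andP[bb be].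
have h0 : 0 <= f t + a' * (0 - t).
  by apply: le_trans (fa 0 _); [apply: f0|]; rewrite lexx ler01.
have h1 : 0 <= f t + a' * (1 - t).
  by apply: le_trans (fa 1 _); [apply: f0|]; rewrite lexx ler01.
exists a, b; split.
  split; [lra|lra|move=> k].
  apply: le_trans (xf k) _; apply: le_trans (fa _ (x01 k)) _.
  have /andP[x0 x1] := x01 k.
  have : 0 <= (ratr a - a') * (x k).1 by rewrite mulr_ge0//; lra.
  lra.
have : (ratr a - a') * t <= e * 1 by apply: ler_pM => //; lra.
have : r = f t + 2 * e by rewrite /e; field.
lra.
Qed.

Lemma least_concave_majorant_fine (R : realType) (x : nat -> R * R) :
  concave_majorants x !=set0 ->
  concave01 (fine \o least_concave_majorant x) /\
  forall t, 0 <= t <= 1 ->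
    least_concave_majorant x t = ((fine \o least_concave_majorant x) t)%:E.
Proof.
move=> xne; have [c [[cc _ _] CE _]] := least_concave_majorant_real xne.
split; last by move=> t t01 /=; rewrite CE.
apply/concave01P => a b t a01 b01 t01 /=.
have abt01 : 0 <= t * a + (1 - t) * b <= 1.
  move: t01 a01 b01 => /andP[t0 t1] /andP[a0 a1] /andP[b0 b1].
  rewrite addr_ge0 ?mulr_ge0 ?subr_ge0//=.
  have : t * a <= t * 1 by rewrite ler_wpM2l.
  have : (1 - t) * b <= (1 - t) * 1 by rewrite ler_wpM2l// subr_ge0.
  lra.
by rewrite !CE//; exact: (concave01P _).1.
Qed.

Section countable_logic.
Context d (T : measurableType d) (I : countType).
Implicit Types Q : I -> T -> Prop.

Lemma measurable_set_ex Q : (forall i, measurable [set w | Q i w]) ->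
  measurable [set w | exists i, Q i w].
Proof.
move=> mQ; have -> : [set w | exists i, Q i w] = \bigcup_i [set w | Q i w].
  by apply/seteqP; split => w /= => [[i Qi]|[i _ Qi]]; exists i.
by apply: countable_bigcupT_measurable => //; exact: countableP.
Qed.

Lemma measurable_set_all Q : (forall i, measurable [set w | Q i w]) ->
  measurable [set w | forall i, Q i w].
Proof.
move=> mQ.
have -> : [set w | forall i, Q i w] = ~` [set w | exists i, ~ Q i w].
  apply/seteqP; split => w /= h; first by case=> i; apply; exact: h.
  by apply: contrapT => /existsNP.
by apply/measurableC/measurable_set_ex => i; apply: measurableC; exact: mQ.
Qed.

End countable_logic.

Section propositional_logic.
Context d (T : measurableType d).
Implicit Types Q : T -> Prop.

Lemma measurable_set_and Q Q' : measurable [set w | Q w] ->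
  measurable [set w | Q' w] -> measurable [set w | Q w /\ Q' w].
Proof. exact: measurableI. Qed.

Lemma measurable_set_or Q Q' : measurable [set w | Q w] ->
  measurable [set w | Q' w] -> measurable [set w | Q w \/ Q' w].
Proof. exact: measurableU. Qed.

Lemma measurable_set_not Q : measurable [set w | Q w] ->
  measurable [set w | ~ Q w].
Proof. exact: measurableC. Qed.

Lemma measurable_set_cst (Q : Prop) : measurable [set _ : T | Q].
Proof.
have [q|q] := pselect Q.
  by rewrite (_ : [set _ | _] = setT)//; apply/seteqP; split.
by rewrite (_ : [set _ | _] = set0)//; apply/seteqP; split.
Qed.

Lemma measurable_set_imp Q Q' : measurable [set w | Q w] ->
  measurable [set w | Q' w] -> measurable [set w | Q w -> Q' w].
Proof.
move=> mQ mQ'.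
rewrite (_ : [set w | Q w -> Q' w] = ~` [set w | Q w] `|` [set w | Q' w]).
  by apply: measurableU => //; exact: measurableC.
apply/seteqP; split => w /=.
  by have [q /(_ q)|] := pselect (Q w); [right|left].
by case.
Qed.

End propositional_logic.

Section measurability.
Context d (T : measurableType d) (R : realType) (U V : nat -> T -> R).
Hypothesis mU : forall k, measurable_fun setT (U k).
Hypothesis mV : forall k, measurable_fun setT (V k).
Hypothesis U01 : forall k w, 0 <= U k w <= 1.

Let x w k := (U k w, V k w).

Lemma measurable_le_set (f g : T -> R) : measurable_fun setT f ->
  measurable_fun setT g -> measurable [set w | f w <= g w].
Proof.
by move=> mf mg; rewrite -[X in measurable X]setTI; exact: measurable_fun_le.
Qed.

Lemma measurable_lt_set (f g : T -> R) : measurable_fun setT f ->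
  measurable_fun setT g -> measurable [set w | f w < g w].
Proof.
move=> mf mg; rewrite (_ : [set w | f w < g w] = ~` [set w | g w <= f w]).
  by apply: measurableC; exact: measurable_le_set.
by apply/seteqP; split => w /=; rewrite ltNge => /negP.
Qed.

Lemma measurable_eq_set (f g : T -> R) : measurable_fun setT f ->
  measurable_fun setT g -> measurable [set w | f w = g w].
Proof.
move=> mf mg; rewrite (_ : [set w | f w = g w] =
    [set w | f w <= g w] `&` [set w | g w <= f w]).
  by apply: measurableI; exact: measurable_le_set.
apply/seteqP; split => w /= [].
  by move=> ->; split.
by move=> h1 h2; apply/eqP; rewrite eq_le h1.
Qed.

Lemma measurable_least_concave_majorant t : 0 < t < 1 ->
  measurable_fun setT (fun w => least_concave_majorant (x w) t).
Proof.
move=> t01; apply: (measurability _ (ErealGenInftyO.measurableE R)).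
move=> _ [_ [r ->]] <-; rewrite setTI.
rewrite (_ : _ @^-1` _ = [set w | exists a b, rat_line_above (x w) a b /\
    ratr a * t + ratr b < r]); last first.
  apply/seteqP; split => w /=; rewrite in_itv/= => h.
    by apply/least_concave_majorant_ltP => // k; exact: U01.
  by apply/least_concave_majorant_ltP => // k; exact: U01.
apply: measurable_set_ex => a; apply: measurable_set_ex => b.
apply: measurable_set_and; last exact: measurable_set_cst.
rewrite (_ : [set w | _] = [set w | 0 <= ratr b :> R /\
    (0 <= ratr a + ratr b :> R /\
     forall k, V k w <= ratr a * U k w + ratr b)]); last first.
  by apply/seteqP; split => w /=; [move=> [? ? ?]|move=> [? [? ?]]]; split.
apply: measurable_set_and; first exact: measurable_set_cst.
apply: measurable_set_and; first exact: measurable_set_cst.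
apply: measurable_set_all => k; apply: measurable_le_set => //.
apply: measurable_funD => //; exact: measurable_funM.
Qed.

Lemma measurable_rat_affine p q :
  measurable [set w | rat_affine (fine \o least_concave_majorant (x w)) p q].
Proof.
have [[p0 pq q1]|no] :=
    pselect [/\ 0 < ratr p :> R, ratr p < ratr q :> R & ratr q < 1 :> R]; last first.
  rewrite (_ : [set w | _] = set0)//; apply/seteqP; split => // w [? ? ? ?].
  by apply: no.
rewrite (_ : [set w | _] = [set w | (fine (least_concave_majorant (x w) (ratr p)) +
    fine (least_concave_majorant (x w) (ratr q)) =
    2 * fine (least_concave_majorant (x w) ((ratr p + ratr q) / 2)))%R]); last first.
  by apply/seteqP; split => w; [case|split].
have mf t : 0 < t < 1 ->
    measurable_fun setT (fun w => fine (least_concave_majorant (x w) t)).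
  move=> t01; apply: measurableT_comp; first exact: fine_measurable.
  exact: measurable_least_concave_majorant.
apply: measurable_eq_set.
  by apply: measurable_funD; apply: mf; apply/andP; split; lra.
by apply: measurable_funM => //; apply: mf; apply/andP; split; lra.
Qed.

(** The value at 1/2 is infinite exactly when there is no concave majorant, in
    which case there is no linearity interval. *)
Lemma measurable_nb_linearity_intervals_eq2 :
  measurable [set w |
    nb_linearity_intervals (least_concave_majorant (x w)) = 2%:R%:E].
Proof.
pose A w p q := rat_affine (fine \o least_concave_majorant (x w)) p q.
have h01 : 0 < (2^-1 : R) < 1 by apply/andP; split; lra.
rewrite (_ : [set w | _] = [set w | least_concave_majorant (x w) 2^-1 <> +oo%E /\
  exists p q p' q' : rat, A w p q /\ A w p' q' /\
    ~ A w (Order.min p p') (Order.max q q') /\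
    forall r s, A w r s ->
      A w (Order.min p r) (Order.max q s) \/
      A w (Order.min p' r) (Order.max q' s)]); last first.
  apply/seteqP; split => w /=.
  - move=> L2; have [x0|/set0P xne] := eqVneq (concave_majorants (x w)) set0.
      move: L2 => /counting_eq2[I [_ [_ [[_ _ [s [_ [Is _ _]]] [a [b abE]]] _] _ _]]].
      by have := abE s Is; rewrite least_concave_majorantNy.
    have [cc CE] := least_concave_majorant_fine xne.
    split; first by rewrite CE//; apply/andP; split; lra.
    have [p [q [p' [q' [? ? ? ?]]]]] := (nb_linearity_intervals_eq2 cc CE).1 L2.
    by exists p, q, p', q'; split.
  - move=> [fin [p [q [p' [q' [? [? [? ?]]]]]]]].
    have xne : concave_majorants (x w) !=set0.
      apply: contrapT => /set0P/negP; rewrite negbK => /eqP x0.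
      by apply: fin; rewrite least_concave_majorantNy.
    have [cc CE] := least_concave_majorant_fine xne.
    by apply/(nb_linearity_intervals_eq2 cc CE); exists p, q, p', q'; split.
apply: measurable_set_and.
  apply: measurable_set_not; rewrite -[X in measurable X]setTI.
  by apply: measurable_eqe => //; exact: measurable_least_concave_majorant.
have mA p q : measurable [set w | A w p q] by exact: measurable_rat_affine.
do 4 apply: measurable_set_ex => ?.
do 3?apply: measurable_set_and => //; first exact: measurable_set_not.
do 2 apply: measurable_set_all => ?.
by apply: measurable_set_imp => //; exact: measurable_set_or.
Qed.

Lemma measurable_dominating : measurable [set w | exists k, dominating (x w) k].
Proof.
apply: measurable_set_ex => k; apply: measurable_set_all => l.
apply: measurable_set_and; apply: measurable_le_set;
  rewrite /x /=; apply: measurable_funM => //; exact: measurable_funB.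
Qed.

End measurability.

(** * Mass of regions of the strip *)

Section intensity_measure.
Context {R : realType} (alpha : R).
Hypothesis alpha01 : 0 < alpha < 1.

Let dens (v : R) : R := alpha * v `^ (- (alpha + 1)).

Let dens_ge0 v : 0 <= dens v.
Proof. by rewrite mulr_ge0 ?powR_ge0//; case/andP: alpha01 => /ltW. Qed.

Let measurable_dens : measurable_fun setT dens.
Proof. by apply: measurable_funM => //; exact: measurable_powR. Qed.

Lemma measurable_strip : measurable (strip : set (R * R)).
Proof. by apply: measurableX => //; exact: measurable_itv. Qed.

Let measurable_dens2 (D : set (R * R)) :
  measurable_fun D (fun p : R * R => (dens p.2)%:E).
Proof.
apply: (@measurable_funS _ _ _ _ setT) => //.
apply/measurable_EFinP; exact: measurableT_comp.
Qed.

Lemma intensity_ge0 A : (0 <= intensity alpha A)%E.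
Proof. by apply: integral_ge0 => p _; rewrite lee_fin; exact: dens_ge0. Qed.

Lemma intensity0 : intensity alpha set0 = 0%E.
Proof. by rewrite /intensity set0I integral_set0. Qed.

Lemma intensityU A B : measurable A -> measurable B -> [disjoint A & B] ->
  intensity alpha (A `|` B) = (intensity alpha A + intensity alpha B)%E.
Proof.
move=> mA mB AB; rewrite /intensity setIUl ge0_integral_setU//.
- by apply: measurableI => //; exact: measurable_strip.
- by apply: measurableI => //; exact: measurable_strip.
- exact: measurable_dens2.
- by move=> p _; rewrite lee_fin; exact: dens_ge0.
- by move: AB; rewrite !disj_set2E => /eqP AB; rewrite setIACA AB set0I.
Qed.

Lemma le_intensity A B : measurable A -> measurable B -> A `<=` B ->
  (intensity alpha A <= intensity alpha B)%E.
Proof.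
move=> mA mB AB; apply: ge0_subset_integral.
- by apply: measurableI => //; exact: measurable_strip.
- by apply: measurableI => //; exact: measurable_strip.
- exact: measurable_dens2.
- by move=> p _; rewrite lee_fin; exact: dens_ge0.
- exact: setSI.
Qed.

Lemma intensity_bigsetU (I : eqType) (s : seq I) (F : I -> set (R * R)) :
  (forall i, measurable (F i)) -> uniq s -> trivIset [set` s] F ->
  intensity alpha (\big[setU/set0]_(i <- s) F i) =
  (\sum_(i <- s) intensity alpha (F i))%E.
Proof.
move=> mF us tF; rewrite /intensity big_distrl/= ge0_integral_bigsetU//.
- by move=> i; exact: (measurableI _ _ (mF i) measurable_strip).
- exact: trivIset_setIr tF.
- exact: measurable_dens2.
- by move=> p _; rewrite lee_fin; exact: dens_ge0.
Qed.

(** The density depends on the height only, so by Fubini only the lengths [l v]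
    of the horizontal slices matter. *)
Lemma intensity_slices (A : set (R * R)) (l : R -> R) : measurable A ->
  (forall v, 0 < v ->
    lebesgue_measure [set u : R | 0 <= u <= 1 /\ A (u, v)] = (l v)%:E) ->
  intensity alpha A =
  (\int[lebesgue_measure]_(v in `]0%R, +oo[) (dens v * l v)%:E)%E.
Proof.
move=> mA lE; rewrite /intensity integral_mkcond.
have mAs : measurable (A `&` strip).
  by apply: measurableI => //; exact: measurable_strip.
rewrite fubini_tonelli2.
- rewrite [RHS]integral_mkcond; apply: eq_integral => v _.
  rewrite /fubini_G patchE.
  transitivity (\int[@lebesgue_measure R]_u
      ((dens v)%:E * (\1_(ysection (A `&` strip) v) u)%:E))%E.
    apply: eq_integral => u _; rewrite patchE indicE mem_ysection.
    by case: ifPn => _; rewrite ?mule1 ?mule0.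
  rewrite ge0_integralZl//; last 2 first.
  + apply/measurable_EFinP; apply: measurable_indic.
    exact: measurable_ysection.
  + by rewrite lee_fin.
  rewrite integral_indic ?setIT//; last exact: measurable_ysection.
  case: ifPn; rewrite ?notin_setE ?inE /= in_itv/= andbT => v0.
    rewrite [RHS]EFinM -lE//; congr (_ * _)%E; congr lebesgue_measure.
    apply/seteqP; split => u; rewrite /ysection/= inE/=.
      by move=> [Auv [/=]]; rewrite !in_itv/=.
    by move=> [u01 Auv]; split => //; split => /=; rewrite in_itv/= ?andbT.
  rewrite [X in lebesgue_measure X](_ : _ = set0) ?measure0 ?mule0//.
  apply/seteqP; split => // u; rewrite /ysection/= inE/= => -[_ [_]] /=.
  by rewrite in_itv/= andbT.
- by apply/(measurable_restrictT _ mAs); exact: measurable_dens2.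
- by move=> p; apply: erestrict_ge0 => q _; rewrite lee_fin; exact: dens_ge0.
Qed.

End intensity_measure.

Section power_integrals.
Context {R : realType}.
Implicit Types (a b : R).

Lemma powR_cvg_pinfty a : 0 < a -> x `^ (- a) @[x --> +oo%R] --> (0 : R).
Proof.
move=> a0; apply/cvgr0Pnorm_le => e e0; near=> x.
have x0 : 0 < x by near: x; exact: nbhs_pinfty_gt.
have Mx : e `^ (- a^-1) <= x by near: x; exact: nbhs_pinfty_ge.
rewrite ger0_norm ?powR_ge0// powRN -[leRHS]invrK lef_pV2 ?posrE ?invr_gt0//;
  last exact: powR_gt0.
have <- : (e `^ (- a^-1)) `^ a = e^-1.
  by rewrite -powRrM mulNr mulVf ?lt0r_neq0// powRN powRr1 ?ltW.
by apply: ge0_ler_powR => //; rewrite ?nnegrE ?powR_ge0 ?ltW.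
Unshelve. all: by end_near. Qed.

Lemma powR_continuous a (x : R) : 0 < x -> {for x, continuous (fun y : R => y `^ a)}.
Proof.
move=> x0; apply: differentiable_continuous; apply/derivable1_diffP.
by apply: derivable_powR; rewrite in_itv/= x0.
Qed.

Lemma integral_powR_tail a b : 0 < a -> 0 < b ->
  (\int[lebesgue_measure]_(v in `]b, +oo[) (a * v `^ (- (a + 1)))%:E)%E =
  (b `^ (- a))%:E.
Proof.
move=> a0 b0.
have dF (v : R) : 0 < v ->
    is_derive v (1 : R) (fun v : R => - v `^ (- a)) (a * v `^ (- (a + 1))).
  move=> v0; have h := is_derive1_powR (- a) v0.
  have -> : a * v `^ (- (a + 1)) = - (- a * v `^ (- a - 1)) by rewrite opprD; ring.
  exact: is_deriveN.
rewrite integral_itv_obnd_cbnd; last first.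
  apply/measurable_EFinP; apply: measurable_funTS; exact: measurable_funM.
rewrite (@ge0_continuous_FTC2y _ _ (fun v : R => - v `^ (- a)) _ 0).
- by rewrite sub0e EFinN oppeK.
- by move=> x _; rewrite mulr_ge0 ?powR_ge0 ?ltW.
- apply: continuous_in_subspaceT => x; rewrite inE/= in_itv/= andbT => bx.
  apply: cvgM; first exact: cvg_cst.
  by apply: powR_continuous; exact: lt_le_trans bx.
- by rewrite -oppr0; apply: cvgN; exact: powR_cvg_pinfty.
- by move=> x bx; apply: ex_derive; apply: dF; exact: lt_trans bx.
- apply: cvgN; apply: cvg_at_right_filter; exact: powR_continuous.
- move=> x; rewrite in_itv/= andbT => bx.
  rewrite derive1E; apply: derive_val; apply: dF; exact: lt_trans bx.
Qed.

(** The integrand is unbounded near 0: the integral is the limit of those over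
    the segments from [b / (n + 2)] to [b]. *)
Lemma integral_powR_head a b : 0 < a < 1 -> 0 < b ->
  (\int[lebesgue_measure]_(v in `]0%R, b]) (v `^ (- a))%:E)%E =
  (b `^ (1 - a) / (1 - a))%:E.
Proof.
move=> /andP[a0 a1] b0.
have a1' : 0 < 1 - a by rewrite subr_gt0.
pose F (v : R) := (1 - a)^-1 * v `^ (1 - a).
have dF (v : R) : 0 < v -> is_derive v (1 : R) F (v `^ (- a)).
  move=> v0; have h := is_derive1_powR (1 - a) v0.
  have -> : v `^ (- a) = (1 - a)^-1 *: ((1 - a) * v `^ (1 - a - 1)).
    by rewrite /GRing.scale/= mulKf ?lt0r_neq0// addrAC subrr sub0r.
  exact: is_deriveZ.
pose e (n : nat) := b / n.+2%:R.
have e0 n : 0 < e n by rewrite divr_gt0.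
have eb n : e n < b by rewrite ltr_pdivrMr// ltr_pMr// ltr1n.
have -> : `]0%R, b]%classic = \bigcup_n `[e n, b]%classic.
  apply/seteqP; split => [v|v [n _]]/=; rewrite !in_itv/=; last first.
    by move=> /andP[/(lt_le_trans (e0 n)) -> ->].
  move=> /andP[h vb].
  exists (Num.Def.archi_bound (b / v)) => //=; rewrite in_itv/= vb andbT.
  rewrite /e ler_pdivrMr// mulrC -ler_pdivrMr// ltW//.
  apply: (@lt_trans _ _ (Num.Def.archi_bound (b / v))%:R).
    by apply: archi_boundP; rewrite divr_ge0 ?ltW.
  by rewrite ltr_nat.
have intE n : (\int[lebesgue_measure]_(v in `[e n, b]) (v `^ (- a))%:E)%E =
    (F b - F (e n))%:E.
  rewrite (@continuous_FTC2 _ _ F)//.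
  - apply: continuous_in_subspaceT => x; rewrite inE/= in_itv/= => /andP[ex _].
    by apply: powR_continuous; exact: lt_le_trans ex.
  - split.
    + move=> x; rewrite in_itv/= => /andP[ex _]; apply: ex_derive; apply: dF.
      exact: lt_trans ex.
    + apply: cvg_at_right_filter; apply: cvgM; first exact: cvg_cst.
      exact: powR_continuous.
    + apply: cvg_at_left_filter; apply: cvgM; first exact: cvg_cst.
      exact: powR_continuous.
  - move=> x; rewrite in_itv/= => /andP[ex _].
    rewrite derive1E; apply: derive_val; apply: dF; exact: lt_trans ex.
have Fe : F (e n) @[n --> \oo] --> (0 : R).
  have -> : (0 : R) = (1 - a)^-1 * 0 by rewrite mulr0.
  apply: cvgM; first exact: cvg_cst.
  move: (powR_cvg0 a1') => /cvg_at_rightP; apply; split => //.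
  have -> : (0 : R) = b * 0 by rewrite mulr0.
  apply: cvgM; first exact: cvg_cst.
  have := @cvg_harmonic R; rewrite -(cvg_shiftS _); exact.
have cvg1 : (\int[lebesgue_measure]_(v in `[e n, b]) (v `^ (- a))%:E)%E
    @[n --> \oo] -->
    (\int[lebesgue_measure]_(v in \bigcup_n `[e n, b]%classic) (v `^ (- a))%:E)%E.
  apply: ge0_nondecreasing_set_cvg_integral => //.
  - move=> m n mn; rewrite subsetEset => v; rewrite /= !in_itv/= => /andP[h ->].
    rewrite andbT; apply: le_trans h; rewrite /e ler_pM2l// lef_pV2 ?posrE//.
    by rewrite ler_nat.
  - move=> n; apply/measurable_EFinP; apply: measurable_funTS.
    exact: measurable_powR.
  - by move=> n v _; rewrite lee_fin powR_ge0.
have cvg2 : (\int[lebesgue_measure]_(v in `[e n, b]) (v `^ (- a))%:E)%E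
    @[n --> \oo] --> (F b)%:E.
  under eq_cvg do rewrite intE.
  apply: cvg_EFin; first by near=> n.
  rewrite [X in _ --> X](_ : _ = F b - 0); last by rewrite subr0.
  by apply: cvgB => //; exact: cvg_cst.
rewrite -(cvg_lim _ cvg1)// (cvg_lim _ cvg2)//; congr EFin.
by rewrite /F mulrC.
Unshelve. all: by end_near. Qed.

End power_integrals.

Section intensity_values.
Context {R : realType} (alpha : R).
Hypothesis alpha01 : 0 < alpha < 1.

Let dens (v : R) : R := alpha * v `^ (- (alpha + 1)).

Let a0 : 0 < alpha. Proof. by case/andP: alpha01. Qed.
Let a1 : 0 < 1 - alpha. Proof. by rewrite subr_gt0; case/andP: alpha01. Qed.

(** In the coordinates p.1 / p.2 and (1 - p.1) / p.2, the points with a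
    coordinate below [x] or [y] respectively: these are the points above the
    lines of slopes [1 / x] and [1 / y] through the feet. *)
Definition low_region (x y : R) : set (R * R) :=
  [set p | p.1 < x * p.2 \/ 1 - p.1 < y * p.2].

(** The points with p.2 > 1 / s, in a form that makes sense for s = 0. *)
Definition high_region (s : R) : set (R * R) := [set p | 1 < s * p.2].

Lemma measurable_low_region x y : measurable (low_region x y).
Proof.
rewrite /low_region; apply: measurable_set_or; apply: measurable_lt_set => //.
- by apply: measurable_funM.
- by apply: measurable_funB.
- by apply: measurable_funM.
Qed.

Lemma measurable_high_region s : measurable (high_region s).
Proof.
by rewrite /high_region; apply: measurable_lt_set => //; exact: measurable_funM.
Qed.

Let measurable_dens : measurable_fun setT dens.
Proof. by apply: measurable_funM => //; exact: measurable_powR. Qed.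

Lemma intensity_high_region s : 0 <= s ->
  intensity alpha (high_region s) = (s `^ alpha)%:E.
Proof.
rewrite le_eqVlt => /predU1P[<-|s0].
  rewrite powR0 ?lt0r_neq0// (_ : high_region 0 = set0) ?intensity0//.
  by apply/seteqP; split => // p; rewrite /high_region/= mul0r ltr10.
pose l (v : R) : R := if s^-1 < v then 1 else 0.
have -> : intensity alpha (high_region s) =
    (\int[lebesgue_measure]_(v in `]0%R, +oo[) (dens v * l v)%:E)%E.
  apply: intensity_slices => //; first exact: measurable_high_region.
  move=> v v0; rewrite /high_region /l/= -ltr_pdivrMl// mulr1.
  case: ifP => sv.
    rewrite (_ : [set u | _] = `[0, 1]%classic).
      by rewrite lebesgue_measure_itv/= lte_fin ltr01 oppr0 adde0.
    by apply/seteqP; split => u /=; rewrite in_itv/=; first by case.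
  by rewrite (_ : [set u | _] = set0) ?measure0//; apply/seteqP; split => u// [].
transitivity (\int[lebesgue_measure]_(v in `]s^-1%R, +oo[) (dens v)%:E)%E.
  rewrite [LHS]integral_mkcond [RHS]integral_mkcond; apply: eq_integral => v _.
  rewrite !patchE /l !mem_setE !in_itv/= !andbT.
  case: ifPn => v0; case: ifPn => sv //; rewrite ?mulr1 ?mulr0//.
  by move: v0; rewrite (lt_trans _ sv)// invr_gt0.
rewrite integral_powR_tail ?invr_gt0//.
by rewrite -[s^-1]powR_inv1 ?ltW// -powRrM mulrNN mul1r.
Qed.

Let slice_low x y v : 0 <= x -> 0 <= y -> 0 < v ->
  lebesgue_measure [set u : R | 0 <= u <= 1 /\ low_region x y (u, v)] =
  (Num.min 1 ((x + y) * v))%:E.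
Proof.
move=> x0 y0 v0; rewrite /low_region/=.
have xv0 : 0 <= x * v by rewrite mulr_ge0// ltW.
have yv0 : 0 <= y * v by rewrite mulr_ge0// ltW.
rewrite mulrDl; case: (ltP 1 (x * v + y * v)) => [h|h].
  rewrite (_ : [set u | _] = `[0, 1]%classic).
    by rewrite lebesgue_measure_itv/= lte_fin ltr01 oppr0 adde0.
  apply/seteqP; split => u /=; rewrite in_itv/=; first by case.
  move=> u01; split => //.
  by have [|] := ltP u (x * v); [left|move=> ?; right; lra].
have E1 : lebesgue_measure `[0, x * v[%classic = (x * v)%:E.
  rewrite lebesgue_measure_itv/= lte_fin; case: ltgtP xv0 => // [_|<-//] _.
  by rewrite oppr0 adde0.
have E2 : lebesgue_measure `]1 - y * v, 1]%classic = (y * v)%:E.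
  rewrite lebesgue_measure_itv/= lte_fin; case: ifPn => [_|].
    by rewrite -EFinB; congr EFin; ring.
  by rewrite -leNgt => ?; congr EFin; lra.
rewrite (_ : [set u | _] = `[0, x * v[%classic `|` `]1 - y * v, 1]%classic).
  rewrite measureU//; last first.
    apply/seteqP; split => // u []/=; rewrite !in_itv/= => /andP[_ ?] /andP[? _].
    exfalso; lra.
  by rewrite EFinD -E1 -E2.
apply/seteqP; split => u /=; rewrite !in_itv/=.
  by move=> [/andP[u0 u1] [ux|uy]]; [left|right]; apply/andP; split => //; lra.
by move=> [/andP[? ?]|/andP[? ?]]; split;
  [apply/andP; split|left|apply/andP; split|right]; lra.
Qed.

(** The slice at height [v] consists of intervals of lengths [x v] and [y v] at
    both ends of the unit interval, which are disjoint until they cover it.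
    Hence only [x + y] matters. *)
Lemma intensity_low_region x y : 0 <= x -> 0 <= y ->
  intensity alpha (low_region x y) = ((x + y) `^ alpha / (1 - alpha))%:E.
Proof.
move=> x0 y0; have : 0 <= x + y by rewrite addr_ge0.
rewrite (intensity_slices alpha01 (l := fun v => Num.min 1 ((x + y) * v)));
  [|exact: measurable_low_region|by move=> v v0; exact: slice_low].
move: (x + y) => {x y x0 y0} s.
rewrite le_eqVlt => /predU1P[<-|s0].
  rewrite powR0 ?lt0r_neq0// mul0r integral0_eq// => v _.
  by rewrite mul0r min_r ?ler01// mulr0.
have si0 : 0 < s^-1 by rewrite invr_gt0.
have -> : `]0%R, +oo[%classic = `]0, s^-1]%classic `|` `]s^-1, +oo[%classic.
  apply/seteqP; split => v /=; rewrite !in_itv/= !andbT.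
    by move=> v0; have [|] := leP v s^-1; [left; rewrite v0|right].
  by move=> [/andP[]//|]; exact: lt_trans.
rewrite ge0_integral_setU//; last 3 first.
- apply/measurable_EFinP; apply: measurable_funTS; apply: measurable_funM => //.
  by apply: measurable_minr => //; exact: measurable_funM.
- move=> v; rewrite /= !in_itv/= andbT => h.
  have v0 : 0 < v by case: h => [/andP[]//|]; exact: lt_trans.
  rewrite lee_fin mulr_ge0// ?le_min ?ler01 ?mulr_ge0 ?powR_ge0// ltW//.
- rewrite disj_set2E; apply/eqP; apply/seteqP; split => // v []/=.
  by rewrite !in_itv/= andbT => /andP[_ h1] /(le_lt_trans h1); rewrite ltxx.
transitivity (\int[lebesgue_measure]_(v in `]0%R, s^-1%R])
    ((alpha * s)%:E * (v `^ (- alpha))%:E) +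
  \int[lebesgue_measure]_(v in `]s^-1%R, +oo[) (dens v)%:E)%E.
  congr (_ + _)%E; apply: eq_integral => v; rewrite inE/= in_itv/=.
    move=> /andP[v0 vs]; rewrite min_r; last first.
      by rewrite -ler_pdivlMl// mulr1.
    rewrite -EFinM; congr EFin; rewrite opprD powRD ?powRN ?powRr1 ?ltW//.
      by field; rewrite !lt0r_neq0// powR_gt0.
    by rewrite lt0r_neq0// implybT.
  rewrite andbT => sv; rewrite min_l ?mulr1//.
  by rewrite -ler_pdivrMl// mulr1 ltW.
rewrite integral_powR_tail// ge0_integralZl_EFin//; last 3 first.
- by move=> v _; rewrite lee_fin powR_ge0.
- by apply/measurable_EFinP; apply: measurable_funTS; exact: measurable_powR.
- by rewrite mulr_ge0// ltW.
rewrite integral_powR_head// -EFinM -EFinD; congr EFin.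
have -> : s^-1 `^ (- alpha) = s `^ alpha.
  by rewrite -[s^-1]powR_inv1 ?ltW// -powRrM mulrNN mul1r.
have -> : s^-1 `^ (1 - alpha) = s `^ alpha / s.
  rewrite -[X in X `^ _]powR_inv1 ?ltW// -powRrM mulN1r opprB.
  rewrite powRD ?powRN ?powRr1 ?ltW//.
  by rewrite lt0r_neq0// implybT.
by field; rewrite !lt0r_neq0.
Qed.

Lemma measurable_sides : measurable ([set p | p.1 = 0 \/ p.1 = 1] : set (R * R)).
Proof. by apply: measurable_set_or; apply: measurable_eq_set. Qed.

Lemma intensity_sides :
  intensity alpha [set p | p.1 = 0 \/ p.1 = 1] = 0%E.
Proof.
rewrite (intensity_slices alpha01 (l := fun=> 0)).
- by rewrite integral0_eq// => v _; rewrite mulr0.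
- exact: measurable_sides.
- move=> v v0; rewrite (_ : [set u | _] = [set 0] `|` [set 1]).
    rewrite measureU//; last first.
      by apply/seteqP; split => // u [/= ->] /eqP; rewrite eq_sym oner_eq0.
    transitivity (lebesgue_measure [set (0%R : R)] +
      lebesgue_measure [set (1%R : R)])%E.
      by [].
    by rewrite !lebesgue_measure_set1 adde0.
  apply/seteqP; split => u /=; first by case.
  by move=> [|] ->; rewrite !lexx !ler01; split => //; [left|right].
Qed.

End intensity_values.

(** * Counts of a Poisson process *)

Section sum_dirac_counting.
Context {R : realType} d (E : measurableType d) (x : nat -> E).
Implicit Types A : set E.

Lemma sum_diracE A :
  sum_dirac x A = counting [set k | A (x k)] :> \bar R.
Proof.
rewrite counting_dirac /sum_dirac /mseries; apply: eq_eseriesr => k _.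
by rewrite /dirac/= !indicE; congr ((_ : bool)%:R%:E); apply/idP/idP; rewrite !inE.
Qed.

Lemma sum_dirac_eq0 A :
  sum_dirac x A = 0%E :> \bar R <-> forall k, ~ A (x k).
Proof.
rewrite sum_diracE; split => [|A0].
  rewrite /counting; case: asboolP => // fA [] /eqP.
  rewrite pnatr_eq0 finmap.cardfs_eq0 => /eqP A0 k Ak.
  have := fset_setK fA; rewrite A0 => h.
  have : [set k | A (x k)] k by [].
  by rewrite -h/= finmap.in_fset0.
by rewrite (_ : [set k | _] = set0) ?measure0//; apply/seteqP; split => k // /A0.
Qed.

Lemma sum_dirac_eq1 A : sum_dirac x A = 1%E :> \bar R ->
  exists k, A (x k) /\ forall l, A (x l) -> l = k.
Proof.
rewrite sum_diracE /counting; case: asboolP => // fA [] /eqP.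
rewrite (eqr_nat R _ 1) => /finmap.cardfs1P[k kE].
have h l : A (x l) <-> l = k.
  have := fset_setK fA; rewrite kE => hA.
  have -> : A (x l) = [set k | A (x k)] l by [].
  by rewrite -hA/= finmap.inE; split => [/eqP|->].
by exists k; split => [|l /h//]; exact/h.
Qed.

Lemma sum_dirac_neqy A : sum_dirac x A <> +oo%E :> \bar R ->
  finite_set [set k | A (x k)].
Proof. by rewrite sum_diracE /counting; case: asboolP. Qed.

End sum_dirac_counting.

Section poisson_law_values.
Context {R : realType}.

Lemma poisson_law_nat (r : R) (n : nat) : 0 <= r ->
  poisson_law r%:E [set n%:R%:E] = (r ^+ n / n`!%:R * expR (- r))%:E.
Proof.
rewrite /poisson_law /poisson_prob.
have -> : [set k : nat | [set n%:R%:E] (k%:R%:E : \bar R)] = [set n].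
  by apply/seteqP; split => k /= => [[/eqP]|->//]; rewrite eqr_nat => /eqP.
rewrite le_eqVlt => /predU1P[<-|r0].
  rewrite ltxx /dirac/= indicE oppr0 expR0 mulr1.
  case: n => [|n]; first by rewrite mem_set//= expr0 fact0 divr1.
  by rewrite memNset//= expr0n mul0r.
by rewrite r0 esum_set1 ?lee_fin ?poisson_pmf_ge0// /poisson_pmf r0.
Qed.

Lemma poisson_law_pinfty (r : R) : poisson_law r%:E [set +oo%E] = 0%E.
Proof.
rewrite /poisson_law /poisson_prob.
have -> : [set k : nat | [set +oo%E] (k%:R%:E : \bar R)] = set0.
  by apply/seteqP; split.
by rewrite esum_set0 /dirac/= indicE in_set0; case: ifP.
Qed.

End poisson_law_values.

Section poisson_process.
Context {R : realType} d (T : measurableType d) (P : probability T R).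
Context dE (E : measurableType dE) (mu : set E -> \bar R) (x : T -> nat -> E).
Hypothesis xP : is_poisson_process P mu (fun w => sum_dirac (x w)).

Let measurable_count A B : measurable A -> measurable (B : set (\bar R)) ->
  measurable [set w | B (sum_dirac (x w) A)].
Proof.
move=> mA mB; have [mrho _ _] := xP.
by have := mrho A mA measurableT B mB; rewrite setTI.
Qed.

Lemma measurable_void A : measurable A ->
  measurable [set w | forall k, ~ A (x w k)].
Proof.
move=> mA; have := measurable_count mA (emeasurable_set1 0%E).
congr (measurable _); apply/seteqP; split => w /=; by move/(@sum_dirac_eq0 R).
Qed.

Lemma void_probability A r : measurable A -> mu A = r%:E -> 0 <= r ->
  P [set w | forall k, ~ A (x w k)] = (expR (- r))%:E.
Proof.
move=> mA Ar r0; have [_ law _] := xP.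
have := law A mA [set 0%:R%:E] (emeasurable_set1 _).
rewrite Ar poisson_law_nat// expr0 fact0 divr1 mul1r => <-; congr (P _).
by apply/seteqP; split => w /=; move/(@sum_dirac_eq0 R).
Qed.

Lemma infinite_probability A r : measurable A -> mu A = r%:E ->
  P [set w | sum_dirac (x w) A = +oo%E :> \bar R] = 0%E.
Proof.
move=> mA Ar; have [_ law _] := xP.
by have := law A mA [set +oo%E] (emeasurable_set1 _); rewrite Ar poisson_law_pinfty.
Qed.

Lemma independent_counts A A' (B B' : set (\bar R)) : measurable A -> measurable A' ->
  A `&` A' = set0 -> measurable B -> measurable B' ->
  P [set w | B (sum_dirac (x w) A) /\ B' (sum_dirac (x w) A')] =
  (P [set w | B (sum_dirac (x w) A)] * P [set w | B' (sum_dirac (x w) A')])%E.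
Proof.
move=> mA mA' AA' mB mB'; have [_ _ indep] := xP.
pose AA (i : 'I_2) := if i == ord0 then A else A'.
pose BB (i : 'I_2) := if i == ord0 then B else B'.
have := indep 2%N AA _ _ BB.
rewrite !big_ord_recl big_ord0 mule1 /AA /BB/= => <-.
- congr (P _); apply/seteqP; split => w /=.
    by move=> [? ?] i; case: ifP.
  by move=> h; split; [exact: (h ord0)|exact: (h ord_max)].
- by move=> i; rewrite /AA; case: ifP.
- apply/trivIsetP => i j _ _; rewrite /AA.
  by case: (unliftP ord0 i) => [i' ->|->]; case: (unliftP ord0 j) => [j' ->|->];
    rewrite ?eqxx//= ?(ord1 i') ?(ord1 j') ?eqxx// setIC.
- by move=> i; rewrite /BB; case: ifP.
Qed.

(** The inequality comes from 1 - exp (- r) <= r. *)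
Lemma hit_void_probability A A' r r' : measurable A -> measurable A' ->
  A `&` A' = set0 -> mu A = r%:E -> mu A' = r'%:E -> 0 <= r -> 0 <= r' ->
  measurable [set w | (exists k, A (x w k)) /\ forall k, ~ A' (x w k)] /\
  (P [set w | (exists k, A (x w k)) /\ forall k, ~ A' (x w k)] <=
    (r * expR (- r'))%:E)%E.
Proof.
move=> mA mA' AA' Ar Ar' r0 r'0.
have E1 : [set w | exists k, A (x w k)] =
    [set w | (~` [set (0%E : \bar R)]) (sum_dirac (x w) A)].
  apply/seteqP; split => w /=; first by move=> [k Ak] /(@sum_dirac_eq0 R)/(_ k).
  by move=> h; apply: contrapT => /forallNP nA; apply/h/(@sum_dirac_eq0 R).
have E2 : [set w | forall k, ~ A' (x w k)] =
    [set w | [set (0%E : \bar R)] (sum_dirac (x w) A')].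
  by apply/seteqP; split => w /=; move/(@sum_dirac_eq0 R).
have mC : measurable (~` [set (0%E : \bar R)] : set (\bar R)) by exact: measurableC.
have E3 : [set w | (exists k, A (x w k)) /\ forall k, ~ A' (x w k)] =
    [set w | (~` [set (0%E : \bar R)]) (sum_dirac (x w) A) /\
      [set (0%E : \bar R)] (sum_dirac (x w) A')].
  rewrite -[LHS]/([set w | exists k, A (x w k)] `&`
    [set w | forall k, ~ A' (x w k)]).
  by rewrite E1 E2.
rewrite E3; split.
  by apply: measurableI; exact: measurable_count.
rewrite independent_counts// -E2 (void_probability mA' Ar' r'0) EFinM.
apply: lee_wpmul2r; first by rewrite lee_fin expR_ge0.
rewrite -E1 (_ : [set w | _] = ~` [set w | forall k, ~ A (x w k)]); last first.
  apply/seteqP; split => w /=; first by move=> [k Ak] /(_ k).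
  by move/existsNP => [k /contrapT]; exists k.
rewrite probability_setC; last exact: measurable_void.
rewrite (void_probability mA Ar r0) -EFinB lee_fin.
have := expR_ge1Dx (- r); lra.
Qed.

Lemma single_void_probability A A' r r' : measurable A -> measurable A' ->
  A `&` A' = set0 -> mu A = r%:E -> mu A' = r'%:E -> 0 <= r -> 0 <= r' ->
  measurable [set w | sum_dirac (x w) A = 1%E :> \bar R /\
    forall k, ~ A' (x w k)] /\
  P [set w | sum_dirac (x w) A = 1%E :> \bar R /\ forall k, ~ A' (x w k)] =
    (r * expR (- (r + r')))%:E.
Proof.
move=> mA mA' AA' Ar Ar' r0 r'0.
have E2 : [set w | forall k, ~ A' (x w k)] =
    [set w | [set (0%E : \bar R)] (sum_dirac (x w) A')].
  by apply/seteqP; split => w /=; move/(@sum_dirac_eq0 R).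
have E3 : [set w | sum_dirac (x w) A = 1%E :> \bar R /\ forall k, ~ A' (x w k)] =
    [set w | [set (1%E : \bar R)] (sum_dirac (x w) A) /\
      [set (0%E : \bar R)] (sum_dirac (x w) A')].
  rewrite -[LHS]/([set w | sum_dirac (x w) A = 1%E :> \bar R] `&`
    [set w | forall k, ~ A' (x w k)]).
  by rewrite E2.
rewrite E3; split.
  by apply: measurableI; exact: measurable_count.
rewrite independent_counts// -E2 (void_probability mA' Ar' r'0).
have [_ law _] := xP.
have := law A mA [set 1%:R%:E] (emeasurable_set1 _); rewrite Ar poisson_law_nat// => ->.
by rewrite expr1 factS fact0 divr1 opprD expRD -EFinM mulrA.
Qed.

End poisson_process.

(** * The grid *)

Section finite_masses.
Context {R : realType} (alpha : R).
Hypothesis alpha01 : 0 < alpha < 1.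
Implicit Types A B : set (R * R).

Definition finite_mass A := measurable A /\ (intensity alpha A < +oo)%E.

Definition mass A : R := fine (intensity alpha A).

Lemma finite_massW A B : measurable A -> finite_mass B -> A `<=` B -> finite_mass A.
Proof.
move=> mA [mB fB] AB; split => //; apply: le_lt_trans fB.
exact: le_intensity.
Qed.

Lemma massE A : finite_mass A -> intensity alpha A = (mass A)%:E.
Proof. by move=> [mA fA]; rewrite fineK// ge0_fin_numE// intensity_ge0. Qed.

Lemma mass_ge0 A : 0 <= mass A.
Proof. exact/fine_ge0/intensity_ge0. Qed.

Lemma massD A B : finite_mass A -> measurable B -> B `<=` A ->
  mass A = mass B + mass (A `\` B).
Proof.
move=> fA mB BA; have [mA _] := fA.
have fB := finite_massW mB fA BA.
have fAB : finite_mass (A `\` B).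
  by apply: (finite_massW _ fA) => //; exact: measurableD.
apply: EFin_inj; rewrite -massE// -[in LHS](setDUK BA) intensityU//.
- by rewrite !massE.
- exact: measurableD.
- by rewrite disj_set2E setDIK.
Qed.

Lemma sum_mass_le (I : eqType) (s : seq I) (F : I -> set (R * R)) B :
  (forall i, measurable (F i)) -> uniq s -> trivIset [set` s] F ->
  finite_mass B -> (forall i, i \in s -> F i `<=` B) ->
  \sum_(i <- s) mass (F i) <= mass B.
Proof.
move=> mF us tF fB FB; rewrite -lee_fin -massE// -sumEFin.
rewrite (eq_big_seq (fun i => intensity alpha (F i))); last first.
  by move=> i si; rewrite massE//; apply: (finite_massW _ fB) => //; exact: FB.
rewrite -intensity_bigsetU//; apply: le_intensity => //.
- by apply: bigsetU_measurable => i _.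
- by case: fB.
- by rewrite big_seq; elim/big_ind: _ => [p []|X Y XB YB p [/XB|/YB]|i /FB].
Qed.

(** The intensity does not charge the complement of the strip, so only the
    points of the strip need to be covered. *)
Lemma mass_le_sum (I : eqType) (s : seq I) (F : I -> set (R * R)) A :
  (forall i, measurable (F i)) -> uniq s -> trivIset [set` s] F ->
  finite_mass A -> (forall p, A p -> strip p -> exists2 i, i \in s & F i p) ->
  mass A <= \sum_(i <- s) mass (A `&` F i).
Proof.
move=> mF us tF fA cover; have [mA _] := fA.
have mAF i : measurable (A `&` F i) by exact: measurableI.
rewrite -lee_fin -massE// -sumEFin.
rewrite (eq_big_seq (fun i => intensity alpha (A `&` F i))); last first.
  by move=> i si; rewrite massE//; apply: (finite_massW _ fA).
rewrite -intensity_bigsetU//; last exact: trivIset_setIl.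
have -> : intensity alpha A = intensity alpha (A `&` strip).
  by rewrite /intensity -setIA setIid.
apply: le_intensity => //.
- by apply: measurableI => //; exact: measurable_strip.
- by apply: bigsetU_measurable => i _.
- move=> p [Ap sp]; have [i si Fp] := cover p Ap sp.
  by rewrite (big_rem i si)/=; left.
Qed.

End finite_masses.

Section grid.
Context {R : realType} (alpha h : R).
Hypotheses (alpha01 : 0 < alpha < 1) (h0 : 0 < h).

(** Division-free form of i h <= y / p.2 < (i + 1) h; it forces p.2 to be
    positive. *)
Definition slab (y : R * R -> R) (i : nat) : set (R * R) :=
  [set p | i%:R * h * p.2 <= y p < i.+1%:R * h * p.2].

Definition cell (i j : nat) : set (R * R) :=
  slab fst i `&` slab (fun p => 1 - p.1) j.

(** The points with 1 / p.2 between k h and (k + 1) h. *)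
Definition level (k : nat) : set (R * R) := slab (fun=> 1) k.

Lemma measurable_slab y i : measurable_fun setT y -> measurable (slab y i).
Proof.
move=> my; rewrite (_ : slab y i = [set p | i%:R * h * p.2 <= y p] `&`
    [set p | y p < i.+1%:R * h * p.2]); last first.
  by apply/seteqP; split => p /=; [move=> /andP[? ?]|move=> [? ?]; apply/andP].
apply: measurableI; [apply: measurable_le_set|apply: measurable_lt_set] => //;
  exact: measurable_funM.
Qed.

Lemma measurable_cell i j : measurable (cell i j).
Proof.
by apply: measurableI; apply: measurable_slab => //; exact: measurable_funB.
Qed.

Lemma measurable_level k : measurable (level k).
Proof. exact: measurable_slab. Qed.

Lemma slab_gt0 y i p : slab y i p -> 0 < p.2.
Proof.
move=> /andP[h1 h2]; have := le_lt_trans h1 h2.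
by rewrite -subr_gt0 -mulrBl -mulrBl -natrB// subSnn mul1r pmulr_rgt0.
Qed.

Lemma slab_inj y i j p : slab y i p -> slab y j p -> i = j.
Proof.
move=> pi pj; have p0 := slab_gt0 pi.
have lt a b : slab y a p -> slab y b p -> (a <= b)%N.
  move=> /andP[h1 _] /andP[_ h2]; have := le_lt_trans h1 h2.
  by rewrite -!mulrA ltr_pM2r ?mulr_gt0// ltr_nat ltnS.
by apply/eqP; rewrite eqn_leq !lt.
Qed.

Lemma slab_exists y p : 0 < p.2 -> 0 <= y p -> exists i, slab y i p.
Proof.
move=> p0 yp; exists (Num.truncn (y p / (h * p.2))).
have hp : 0 < h * p.2 by rewrite mulr_gt0.
have /andP[h1 h2] : (Num.truncn (y p / (h * p.2)))%:R <= y p / (h * p.2) <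
    (Num.truncn (y p / (h * p.2))).+1%:R.
  by apply: truncn_itv; rewrite divr_ge0// ltW.
by rewrite /slab/= -!mulrA -ler_pdivlMr// h1 -ltr_pdivrMr.
Qed.

(** The coordinates p.1 / p.2 and (1 - p.1) / p.2 add up to 1 / p.2. *)
Lemma cell_level i j k p : cell i j p -> level k p -> (i + j <= k <= i + j + 1)%N.
Proof.
move=> [ci cj] lk; have p0 := slab_gt0 ci.
have hp : 0 < h * p.2 by rewrite mulr_gt0.
move: ci cj lk; rewrite /level /slab/= -!mulrA.
move=> /andP[i1 i2] /andP[j1 j2] /andP[k1 k2].
apply/andP; split.
  rewrite -ltnS -(ltr_nat R) -(ltr_pM2r hp); apply: le_lt_trans k2.
  by rewrite natrD mulrDl; lra.
rewrite addn1 -ltnS -(ltr_nat R) -(ltr_pM2r hp); apply: le_lt_trans k1 _.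
have -> : ((i + j).+2%:R : R) = i.+1%:R + j.+1%:R by rewrite -natrD addSn addnS.
by rewrite mulrDl; lra.
Qed.

Lemma cell_exists k p : level k p -> strip p ->
  exists i j, [/\ (i <= k)%N, (j <= k)%N & cell i j p].
Proof.
move=> lk [/=]; rewrite !in_itv/= andbT => /andP[u0 u1] v0.
have [i ci] := @slab_exists fst p v0 u0.
have [j cj] : exists j, slab (fun p => 1 - p.1) j p.
  by apply: slab_exists => //; rewrite subr_ge0.
exists i, j; split => //.
  have /andP[h1 _] := cell_level (conj ci cj) lk.
  exact: leq_trans (leq_addr _ _) h1.
have /andP[h1 _] := cell_level (conj ci cj) lk.
exact: leq_trans (leq_addl _ _) h1.
Qed.

Lemma trivIset_cell (s : seq (nat * nat)) :
  trivIset [set` s] (fun ij => cell ij.1 ij.2).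
Proof.
move=> [i j] [i' j'] _ _ [p [[/= ci cj] [ci' cj']]].
by rewrite (slab_inj ci ci') (slab_inj cj cj').
Qed.

Lemma trivIset_level (s : seq nat) : trivIset [set` s] level.
Proof. by move=> k k' _ _ [p [lk lk']]; exact: slab_inj lk lk'. Qed.

Lemma cell_low_region i j : cell i j `<=` low_region (i.+1%:R * h) (j.+1%:R * h).
Proof. by move=> p [/andP[_ h1] _]; left. Qed.

Lemma cell_not_low_region i j :
  cell i j `&` low_region (i%:R * h) (j%:R * h) = set0.
Proof.
apply/seteqP; split => // p [[/andP[h1 _] /andP[h2 _]] [|]].
  by rewrite ltNge h1.
by rewrite ltNge h2.
Qed.

Let t (k : nat) : R := (k%:R * h) `^ alpha.

Lemma finite_mass_low_region x y : 0 <= x -> 0 <= y ->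
  finite_mass alpha (low_region x y).
Proof.
move=> x0 y0; split; first exact: measurable_low_region.
by rewrite intensity_low_region// ltry.
Qed.

Lemma mass_low_region i j :
  mass alpha (low_region (i%:R * h) (j%:R * h)) = t (i + j) / (1 - alpha).
Proof.
rewrite /mass intensity_low_region// ?mulr_ge0 ?(ltW h0)//=.
by rewrite /t natrD mulrDl.
Qed.

Lemma finite_mass_cell i j : finite_mass alpha (cell i j).
Proof.
apply: (finite_massW alpha01) (@cell_low_region i j).
  exact: measurable_cell.
by apply: finite_mass_low_region; rewrite mulr_ge0// ltW.
Qed.

Lemma finite_mass_high_region k : finite_mass alpha (high_region (k%:R * h)).
Proof.
split; first exact: measurable_high_region.
by rewrite intensity_high_region ?ltry// mulr_ge0// ltW.
Qed.

Lemma levelE k : level k `<=` high_region (k.+1%:R * h).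
Proof. by move=> p /andP[]. Qed.

Lemma finite_mass_level k : finite_mass alpha (level k).
Proof.
apply: (finite_massW alpha01) (@levelE k); last exact: finite_mass_high_region.
exact: measurable_level.
Qed.

(** A level is the difference of two high regions. *)
Lemma mass_level k : mass alpha (level k) = t k.+1 - t k.
Proof.
have massH n : mass alpha (high_region (n%:R * h)) = t n.
  by rewrite /mass intensity_high_region// mulr_ge0// ltW.
rewrite -!massH.
rewrite (massD alpha01 (finite_mass_high_region k.+1) (measurable_level k)).
  rewrite [X in _ + mass _ X - _](_ : _ = high_region (k%:R * h)) ?addrK//.
  apply/seteqP; split => p /=.
    rewrite /high_region/level/slab/= => -[h1]; rewrite h1 andbT => /negP.
    by rewrite -ltNge.
  rewrite /high_region/level/slab/= => h1; split; last by rewrite leNgt h1.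
  have p0 : 0 < p.2.
    rewrite ltNge; apply/negP => p0; have : k%:R * h * p.2 <= 0.
      by rewrite mulr_ge0_le0// mulr_ge0// ltW.
    lra.
  apply: lt_le_trans h1 _; rewrite ler_pM2r// ler_pM2r// ler_nat//.
exact: levelE.
Qed.

End grid.

(** * Riemann sums of the exponential *)

Lemma powRD_le (R : realType) (a x y : R) : 0 < a <= 1 -> 0 <= x -> 0 <= y ->
  (x + y) `^ a <= x `^ a + y `^ a.
Proof.
move=> /andP[a0 a1].
rewrite le_eqVlt => /predU1P[<-|x0].
  by rewrite add0r lerDr powR_ge0.
rewrite le_eqVlt => /predU1P[<-|y0].
  by rewrite addr0 lerDl powR_ge0.
have s0 : 0 < x + y by rewrite addr_gt0.
have sa0 : 0 < (x + y) `^ a by rewrite powR_gt0.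
have part z : 0 < z -> z <= x + y -> (x + y) `^ a * (z / (x + y)) <= z `^ a.
  move=> z0 zs; have zE : z = (x + y) * (z / (x + y)) by field; lra.
  have zs0 : 0 < z / (x + y) by rewrite divr_gt0.
  rewrite [in leRHS]zE powRM ?(ltW s0) ?(ltW zs0)// ler_pM2l// ger1_powR// zs0/=.
  by rewrite ler_pdivrMr// mul1r.
have := part x x0 _; have := part y y0 _.
move=> hy hx; apply: le_trans (lerD (hx _) (hy _)); [|lra|lra].
by rewrite -mulrDr -mulrDl divff ?mulr1// lt0r_neq0.
Qed.

Section exponential_riemann_sums.
Context {R : realType} (t : nat -> R) (c w : R).
Hypotheses (c0 : 0 < c) (t0 : t 0%N = 0) (t_mono : forall k, t k <= t k.+1).

Let telescope n : \sum_(k <- iota 0 n) (expR (- (c * t k)) - expR (- (c * t k.+1)))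
  = 1 - expR (- (c * t n)).
Proof.
have := @telescope_sumr _ 0 n (fun k => - expR (- (c * t k))) (leq0n n).
rewrite t0 mulr0 oppr0 expR0 opprK [RHS]addrC /index_iota subn0 => <-.
by apply: eq_bigr => k _; rewrite opprK addrC.
Qed.

(** Both lemmas compare a term of the sum with an increment of
    exp (- c t) / c over the same step, by 1 + x <= exp x; [w] bounds the shift
    of the evaluation point. *)
Lemma exp_riemann_sum_le n : (forall k, t k.+1 <= t k.-1 + w) ->
  \sum_(k <- iota 0 n) (t k.+1 - t k) * expR (- (c * t k.-1)) <=
  c^-1 * expR (c * w).
Proof.
move=> tw.
apply: (@le_trans _ _ (\sum_(k <- iota 0 n)
    c^-1 * expR (c * w) * (expR (- (c * t k)) - expR (- (c * t k.+1))))).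
  apply: ler_sum => k _.
  have dt : 0 <= t k.+1 - t k by rewrite subr_ge0.
  have h1 : expR (- (c * t k.-1)) <= expR (c * w) * expR (- (c * t k.+1)).
    rewrite -expRD ler_expR.
    have : c * t k.+1 <= c * (t k.-1 + w) by rewrite ler_pM2l.
    lra.
  apply: (le_trans (ler_wpM2l dt h1)).
  rewrite mulrCA [leRHS]mulrAC [leRHS]mulrC ler_pM2l ?expR_gt0//.
  rewrite -(ler_pM2l c0) mulVKf ?lt0r_neq0// mulrA mulrBr.
  have -> : expR (- (c * t k)) = expR (c * t k.+1 - c * t k) * expR (- (c * t k.+1)).
    by rewrite -expRD; congr expR; ring.
  rewrite -[X in _ <= _ - X]mul1r -mulrBl ler_pM2r ?expR_gt0//.
  by rewrite lerBrDl expR_ge1Dx.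
rewrite -mulr_sumr telescope mulrBr mulr1 gerBl.
by rewrite mulr_ge0 ?expR_ge0// mulr_ge0 ?expR_ge0// invr_ge0 ltW.
Qed.

Lemma exp_riemann_sum_ge n : (forall k, t k.+2 <= t k + w) ->
  c^-1 * expR (- (c * w)) * (1 - expR (- (c * t n))) <=
  \sum_(k <- iota 0 n) (t k.+1 - t k) * expR (- (c * t k.+2)).
Proof.
move=> tw; rewrite -telescope mulr_sumr; apply: ler_sum => k _.
have dt : 0 <= t k.+1 - t k by rewrite subr_ge0.
have h1 : expR (- (c * w)) * expR (- (c * t k)) <= expR (- (c * t k.+2)).
  rewrite -expRD ler_expR.
  have : c * t k.+2 <= c * (t k + w) by rewrite ler_pM2l.
  lra.
apply: (le_trans _ (ler_wpM2l dt h1)).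
rewrite [leRHS]mulrCA [leLHS]mulrAC [leLHS]mulrC ler_pM2l ?expR_gt0//.
rewrite -(ler_pM2l c0) mulVKf ?lt0r_neq0// mulrA mulrBr.
have -> : expR (- (c * t k.+1)) = expR (- (c * t k.+1 - c * t k)) * expR (- (c * t k)).
  by rewrite -expRD; congr expR; ring.
rewrite -[X in X - _ <= _]mul1r -mulrBl ler_pM2r ?expR_gt0//.
have := expR_ge1Dx (- (c * t k.+1 - c * t k)); lra.
Qed.

End exponential_riemann_sums.

(** * Finite unions of events *)

Section finite_unions.
Context d (T : measurableType d) (R : realType) (P : probability T R).
Context (I : eqType) (F : I -> set T).
Hypothesis mF : forall i, measurable (F i).

Lemma probability_bigcup_le (s : seq I) (A : set T) : measurable A ->
  (forall w, A w -> exists2 i, i \in s & F i w) ->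
  (P A <= \sum_(i <- s) P (F i))%E.
Proof.
elim: s A => [|i s ih] A mA cover.
  by rewrite big_nil (_ : A = set0) ?measure0//; apply/seteqP; split => // w /cover[].
rewrite big_cons (_ : A = (A `&` F i) `|` (A `\` F i)); last by rewrite setUIDK.
apply: (le_trans (measureU2 _ _ _)).
- exact: measurableI.
- exact: measurableD.
apply: leeD.
  by apply: le_measure; rewrite ?inE//; exact: measurableI.
apply: ih; first exact: measurableD.
move=> w [Aw nF]; have [j] := cover w Aw.
by rewrite inE => /orP[/eqP->//|js Fj]; exists j.
Qed.

Lemma sum_probability_le (s : seq I) (A : set T) : measurable A -> uniq s ->
  trivIset [set` s] F -> (forall i, i \in s -> F i `<=` A) ->
  (\sum_(i <- s) P (F i) <= P A)%E.
Proof.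
elim: s A => [|i s ih] A mA; first by rewrite big_nil measure_ge0.
move=> /= /andP[is_ us] tF FA.
rewrite big_cons (_ : P A = P (A `&` F i) + P (A `\` F i))%E; last first.
  rewrite -measureU ?setUIDK//; [exact: measurableI|exact: measurableD|].
  by apply/seteqP; split => // w [[_ Fw] [_ /(_ Fw)]].
apply: leeD.
  apply: le_measure; rewrite ?inE//; first exact: measurableI.
  by move=> w Fw; split => //; apply: (FA i); rewrite ?mem_head.
apply: ih => //; first exact: measurableD.
  by apply: sub_trivIset tF => j /= js; rewrite inE js orbT.
move=> j js w Fj; split; first by apply: (FA j); rewrite // inE js orbT.
move=> Fi; move: is_; rewrite (tF i j) ?js//=; first exact: mem_head.
  by rewrite inE js orbT.
by exists w.
Qed.

End finite_unions.

(** * Bounds for the probability of a dominating point *)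

Section sandwich.
Context {R : realType} (alpha : R) d (T : measurableType d) (P : probability T R).
Context (x : T -> nat -> R * R).
Hypothesis alpha01 : 0 < alpha < 1.
Hypothesis xP : is_poisson_process P (intensity alpha) (fun w => sum_dirac (x w)).
Hypothesis xstrip : forall w k, strip (x w k).

Let G := [set w | exists k, dominating (x w) k].
Hypothesis mG : measurable G.

Let c := (1 - alpha)^-1.
Let c0 : 0 < c. Proof. by rewrite invr_gt0 subr_gt0; case/andP: alpha01. Qed.
Let a0 : 0 < alpha. Proof. by case/andP: alpha01. Qed.

Variables (h : R) (N : nat).
Hypothesis h0 : 0 < h.
Let t (k : nat) : R := (k%:R * h) `^ alpha.

Let t_homo i j : (i <= j)%N -> t i <= t j.
Proof.
move=> ij; apply: ge0_ler_powR; rewrite ?nnegrE ?mulr_ge0 ?(ltW a0) ?(ltW h0)//.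
by rewrite ler_pM2r// ler_nat.
Qed.

Let t0 : t 0%N = 0. Proof. by rewrite /t mul0r powR0// lt0r_neq0. Qed.

Let t_add2 k : t k.+2 <= t k + (2 * h) `^ alpha.
Proof.
rewrite /t -addn2 natrD mulrDl; apply: powRD_le.
- by rewrite a0/=; case/andP: alpha01 => _ /ltW.
- by rewrite mulr_ge0// ltW.
- by rewrite mulr_ge0// ltW.
Qed.

Let pairs := [seq (i, j) | i <- iota 0 N, j <- iota 0 N].

Let pairsP ij : (ij \in pairs) = (ij.1 < N)%N && (ij.2 < N)%N.
Proof.
apply/allpairsP/andP => [[[i j] /= [+ + ->]]|[iN jN]].
  by rewrite !mem_iota.
by exists ij; rewrite !mem_iota; case: ij iN jN.
Qed.

Let uniq_pairs : uniq pairs.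
Proof. by apply: allpairs_uniq; rewrite ?iota_uniq// => -[? ?] [? ?]. Qed.

Let ih0 i : 0 <= i%:R * h. Proof. by rewrite mulr_ge0// ltW. Qed.

(* Cells are compared with levels, whose masses are known increments: a cell
   meets the levels i + j and i + j + 1 only.  The bound is uniform in the size
   of the grid. *)
Let cell_sum_le :
  \sum_(p <- pairs) mass alpha (cell h p.1 p.2) * expR (- (c * t (p.1 + p.2))) <=
  c^-1 * expR (c * (2 * h) `^ alpha).
Proof.
apply: le_trans (exp_riemann_sum_le c0 t0 _ (2 * N) _); last 2 first.
- by move=> k; apply: t_homo.
- by case=> [|k] /=; [apply: le_trans (t_add2 _); exact: t_homo|exact: t_add2].
apply: (@le_trans _ _ (\sum_(p <- pairs) \sum_(k <- iota 0 (2 * N))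
    mass alpha (cell h p.1 p.2 `&` level h k) * expR (- (c * t k.-1)))).
  rewrite big_seq [leRHS]big_seq; apply: ler_sum => p.
  rewrite pairsP => /andP[iN jN].
  have mp : mass alpha (cell h p.1 p.2) <=
      \sum_(k <- iota 0 (2 * N)) mass alpha (cell h p.1 p.2 `&` level h k).
    apply: (mass_le_sum alpha01).
    - by move=> k; exact: measurable_level.
    - exact: iota_uniq.
    - exact: trivIset_level.
    - exact: finite_mass_cell.
    - move=> z cz [_ /=]; rewrite in_itv/= andbT => z0.
      have [k lk] := slab_exists (y := fun=> 1) h0 z0 ler01.
      exists k => //; have /andP[_] := cell_level h0 cz lk.
      rewrite mem_iota /= add0n => kij; apply: leq_ltn_trans kij _.
      by rewrite mul2n -addnn addn1 -addnS -addSn; exact: (leq_add iN jN).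
  apply: (le_trans (ler_wpM2r (expR_ge0 _) mp)); rewrite mulr_suml.
  apply: ler_sum => k _.
  have [E|/set0P[z [cz lz]]] := eqVneq (cell h p.1 p.2 `&` level h k) set0.
    by rewrite E /mass intensity0 !mul0r.
  apply: ler_wpM2l; first exact: mass_ge0.
  rewrite ler_expR lerN2 ler_pM2l//; apply: t_homo.
  by have /andP[_ hk] := cell_level h0 cz lz; rewrite -subn1 leq_subLR addnC.
rewrite exchange_big/=; apply: ler_sum => k _; rewrite -mulr_suml.
apply: ler_wpM2r; first exact: expR_ge0.
rewrite -(mass_level alpha01 h0); apply: (sum_mass_le alpha01).
- by move=> p; apply: measurableI; [exact: measurable_cell|exact: measurable_level].
- exact: uniq_pairs.
- exact/trivIset_setIr/trivIset_cell.
- exact: finite_mass_level.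
- by move=> p _; exact: subIsetr.
Qed.

(* The first N levels of the strip are covered by the N x N grid. *)
Let cell_sum_ge :
  c^-1 * expR (- (c * (2 * h) `^ alpha)) * (1 - expR (- (c * t N))) <=
  \sum_(p <- pairs)
    mass alpha (cell h p.1 p.2) * expR (- (c * t (p.1 + p.2).+2)).
Proof.
apply: (le_trans (exp_riemann_sum_ge c0 t0 _ _ t_add2)).
  by move=> k; apply: t_homo.
apply: (@le_trans _ _ (\sum_(p <- pairs) \sum_(k <- iota 0 N)
    mass alpha (cell h p.1 p.2 `&` level h k) * expR (- (c * t k.+2)))).
  rewrite exchange_big/= big_seq [leRHS]big_seq; apply: ler_sum => k.
  rewrite mem_iota/= add0n => kN; rewrite -mulr_suml.
  apply: ler_wpM2r; first exact: expR_ge0.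
  rewrite -(mass_level alpha01 h0).
  under eq_bigr do rewrite setIC.
  apply: (mass_le_sum alpha01 (F := fun p => cell h p.1 p.2)).
  - by move=> p; exact: measurable_cell.
  - exact: uniq_pairs.
  - exact: trivIset_cell.
  - exact: finite_mass_level.
  - move=> z lz sz; have [i [j [ik jk cz]]] := cell_exists h0 lz sz.
    by exists (i, j) => //; rewrite pairsP/= !(leq_ltn_trans _ kN).
apply: ler_sum => p _.
apply: (@le_trans _ _ (\sum_(k <- iota 0 N)
    mass alpha (cell h p.1 p.2 `&` level h k) * expR (- (c * t (p.1 + p.2).+2)))).
  apply: ler_sum => k _.
  have [E|/set0P[z [cz lz]]] := eqVneq (cell h p.1 p.2 `&` level h k) set0.
    by rewrite E /mass intensity0 !mul0r.
  apply: ler_wpM2l; first exact: mass_ge0.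
  rewrite ler_expR lerN2 ler_pM2l//; apply: t_homo.
  by have /andP[] := cell_level h0 cz lz.
rewrite -mulr_suml; apply: ler_wpM2r; first exact: expR_ge0.
apply: (sum_mass_le alpha01).
- by move=> k; apply: measurableI; [exact: measurable_cell|exact: measurable_level].
- exact: iota_uniq.
- exact/trivIset_setIl/trivIset_level.
- exact: finite_mass_cell.
- by move=> k _; exact: subIsetl.
Qed.

Let void x' y := [set w | forall k, ~ low_region x' y (x w k)].

Let void_prob i j : P (void (i%:R * h) (j%:R * h)) = (expR (- (c * t (i + j))))%:E.
Proof.
have fm := finite_mass_low_region alpha01 (ih0 i) (ih0 j).
rewrite (void_probability xP (r := t (i + j) / (1 - alpha))).
- by rewrite mulrC.
- by case: fm.
- by rewrite (massE alpha01 fm) mass_low_region.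
- by apply: mulr_ge0; [exact: powR_ge0|exact: ltW c0].
Qed.

Let measurable_void_low x' y : measurable (void x' y).
Proof. apply: (measurable_void xP); exact: measurable_low_region. Qed.

Let hit (p : nat * nat) := [set w | (exists k, cell h p.1 p.2 (x w k)) /\
  forall k, ~ low_region (p.1%:R * h) (p.2%:R * h) (x w k)].

Let hit_prob p : measurable (hit p) /\
  (P (hit p) <= (mass alpha (cell h p.1 p.2) *
    expR (- (c * t (p.1 + p.2))))%:E)%E.
Proof.
have fm := finite_mass_low_region alpha01 (ih0 p.1) (ih0 p.2).
have fc := finite_mass_cell alpha01 h0 p.1 p.2.
rewrite [c * _]mulrC; apply: (hit_void_probability xP).
- exact: measurable_cell.
- exact: measurable_low_region.
- exact: cell_not_low_region.
- exact: massE.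
- by rewrite (massE alpha01 fm) mass_low_region.
- exact: mass_ge0.
- by apply: mulr_ge0; [exact: powR_ge0|exact: ltW c0].
Qed.

(** The apex is in one of the N x N cells, unless one of its coordinates is at
    least N h, in which case no point at all has this coordinate below N h; the
    last term bounds the probability of this. *)
Lemma dominating_probability_le :
  (P G <= (c^-1 * expR (c * (2 * h) `^ alpha) + 2 * expR (- (c * t N)))%:E)%E.
Proof.
pose K := (\big[setU/set0]_(p <- pairs) hit p).
have mK : measurable K.
  by apply: bigsetU_measurable => p _; case: (hit_prob p).
have sub : G `<=` K `|` (void (N%:R * h) (0%:R * h) `|` void (0%:R * h) (N%:R * h)).
  move=> w [k dk].
  have [] := xstrip w k; rewrite /= !in_itv/= andbT => /andP[u0 u1] v0.
  have u1' : 0 <= 1 - (x w k).1 by rewrite subr_ge0.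
  have vl l : 0 < (x w l).2 by have [_] := xstrip w l; rewrite /= in_itv/= andbT.
  have ul l : 0 <= (x w l).1 <= 1 by have [] := xstrip w l; rewrite /= in_itv/=.
  (* the coordinates of the apex are minimal *)
  have away b : b * (x w k).2 <= (x w k).1 -> forall l, b * (x w l).2 <= (x w l).1.
    move=> bk l; have [dl _] := dk l.
    rewrite -(ler_pM2r v0) mulrAC; apply: (@le_trans _ _ ((x w k).1 * (x w l).2)).
      by rewrite ler_pM2r.
    by rewrite mulrC [leRHS]mulrC.
  have away' b : b * (x w k).2 <= 1 - (x w k).1 ->
      forall l, b * (x w l).2 <= 1 - (x w l).1.
    move=> bk l; have [_ dl] := dk l.
    rewrite -(ler_pM2r v0) mulrAC; apply: (@le_trans _ _ ((1 - (x w k).1) * (x w l).2)).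
      by rewrite ler_pM2r.
    by rewrite mulrC [leRHS]mulrC.
  have [i ci] := slab_exists (y := fst) h0 v0 u0.
  have [j cj] := slab_exists (y := fun p => 1 - p.1) h0 v0 u1'.
  have /andP[i1 _] := ci; have /andP[j1 _] := cj.
  have le_ih (m n : nat) : (m <= n)%N -> m%:R * h * (x w k).2 <= n%:R * h * (x w k).2.
    by move=> mn; rewrite ler_pM2r// ler_pM2r// ler_nat.
  have [iN|Ni] := ltnP i N; last first.
    right; left => l [|]; apply/negP; rewrite -leNgt.
      by apply: away; apply: le_trans i1; exact: le_ih.
    by rewrite !mul0r subr_ge0; case/andP: (ul l).
  have [jN|Nj] := ltnP j N; last first.
    right; right => l [|]; apply/negP; rewrite -leNgt.
      by rewrite !mul0r; case/andP: (ul l).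
    by apply: away'; apply: le_trans j1; exact: le_ih.
  left; rewrite /K (big_rem (i, j)) ?pairsP/= ?iN ?jN//; left; split.
    by exists k; split.
  by move=> l [|]; apply/negP; rewrite -leNgt; [exact: away|exact: away'].
apply: (@le_trans _ _ (P (K `|`
    (void (N%:R * h) (0%:R * h) `|` void (0%:R * h) (N%:R * h))))).
  by apply: le_measure; rewrite ?inE//; do ?apply: measurableU.
apply: (le_trans (measureU2 _ _ _)) => //; first exact: measurableU.
rewrite EFinD; apply: leeD.
  apply: (@le_trans _ _ (\sum_(p <- pairs) P (hit p))%E).
    apply: probability_bigcup_le => //; first by move=> p; case: (hit_prob p).
    rewrite /K; elim: pairs => [|p s ih] w; first by rewrite big_nil.
    rewrite big_cons => -[hp|/ih[q qs hq]]; first by exists p; rewrite ?mem_head.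
    by exists q; rewrite // inE qs orbT.
  apply: le_trans (_ : _ <= (\sum_(p <- pairs) mass alpha (cell h p.1 p.2) *
    expR (- (c * t (p.1 + p.2))))%:E)%E _; last by rewrite lee_fin cell_sum_le.
  rewrite -sumEFin; apply: lee_sum => p _; by case: (hit_prob p).
apply: (@le_trans _ _ (P (void (N%:R * h) (0%:R * h)) +
  P (void (0%:R * h) (N%:R * h)))%E); first exact: measureU2.
by rewrite !void_prob addn0 add0n -EFinD lee_fin mulr2n mulrDl mul1r.
Qed.

Let single (p : nat * nat) := [set w |
  sum_dirac (x w) (cell h p.1 p.2) = 1%E :> \bar R /\
  forall k, ~ (low_region (p.1.+1%:R * h) (p.2.+1%:R * h) `\` cell h p.1 p.2) (x w k)].

Let single_prob p : measurable (single p) /\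
  P (single p) = (mass alpha (cell h p.1 p.2) *
    expR (- (c * t (p.1 + p.2).+2)))%:E.
Proof.
have fm := finite_mass_low_region alpha01 (ih0 p.1.+1) (ih0 p.2.+1).
have fc := finite_mass_cell alpha01 h0 p.1 p.2.
have mc := measurable_cell h p.1 p.2.
have mD : measurable (low_region (p.1.+1%:R * h) (p.2.+1%:R * h) `\` cell h p.1 p.2).
  by apply: measurableD => //; exact: measurable_low_region.
have fD : finite_mass alpha
    (low_region (p.1.+1%:R * h) (p.2.+1%:R * h) `\` cell h p.1 p.2).
  exact: (finite_massW alpha01 mD fm).
have -> : c * t (p.1 + p.2).+2 = mass alpha (cell h p.1 p.2) +
    mass alpha (low_region (p.1.+1%:R * h) (p.2.+1%:R * h) `\` cell h p.1 p.2).
  rewrite -(massD alpha01 fm mc); last exact: cell_low_region.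
  by rewrite mass_low_region// addSn addnS mulrC.
apply: (single_void_probability xP) => //.
- by apply/seteqP; split => // z [? []].
- exact: massE.
- exact: massE.
- exact: mass_ge0.
- exact: mass_ge0.
Qed.

(** The events [single] are disjoint: the only point of a cell is in the region
    below the upper corner of any cell with a larger index in one direction. *)
Lemma dominating_probability_ge :
  ((c^-1 * expR (- (c * (2 * h) `^ alpha)) * (1 - expR (- (c * t N))))%:E <= P G)%E.
Proof.
apply: (@le_trans _ _ (\sum_(p <- pairs) P (single p))%E).
  apply: le_trans (_ : _ <= (\sum_(p <- pairs) mass alpha (cell h p.1 p.2) *
    expR (- (c * t (p.1 + p.2).+2)))%:E)%E _; first by rewrite lee_fin cell_sum_ge.
  by rewrite -sumEFin; apply: lee_sum => p _; case: (single_prob p) => _ ->.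
apply: sum_probability_le => //.
- by move=> p; case: (single_prob p).
- have le_cell w a b a' b' : single (a, b) w -> single (a', b') w ->
      (a' <= a)%N /\ (b' <= b)%N.
    move=> [/= s1 _] [_ /= v2]; have [k [[ca cb] _]] := sum_dirac_eq1 s1.
    have k0 := slab_gt0 h0 ca.
    have grow (m n : nat) : (m < n)%N ->
        m.+1%:R * h * (x w k).2 <= n.+1%:R * h * (x w k).2.
      by move=> mn; rewrite ler_pM2r// ler_pM2r// ler_nat ltnW.
    split; rewrite leqNgt; apply/negP => ab; apply: (v2 k); split => /=.
    + left; have /andP[_ h1] := ca; apply: lt_le_trans h1 _; exact: grow.
    + by move=> [ca' _]; move: ab; rewrite (slab_inj h0 ca ca') ltnn.
    + right; have /andP[_ h1] := cb; apply: lt_le_trans h1 _; exact: grow.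
    + by move=> [_ cb']; move: ab; rewrite (slab_inj h0 cb cb') ltnn.
  move=> [i j] [i' j'] _ _ [w [s1 s2]].
  have [h1 h2] := le_cell _ _ _ _ _ s1 s2; have [h3 h4] := le_cell _ _ _ _ _ s2 s1.
  by congr pair; apply/eqP; rewrite eqn_leq ?h1 ?h2 ?h3 ?h4.
- move=> [i j] _ w [/sum_dirac_eq1[k [[/= ci cj] uk]] v]; exists k => l.
  have [->//|/eqP lk] := eqVneq l k.
  have vl : 0 < (x w l).2 by have [_] := xstrip w l; rewrite /= in_itv/= andbT.
  have vk : 0 < (x w k).2 by have [_] := xstrip w k; rewrite /= in_itv/= andbT.
  have /andP[_ h1] := ci; have /andP[_ h2] := cj.
  have nl : ~ low_region (i.+1%:R * h) (j.+1%:R * h) (x w l).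
    by move=> ll; apply: (v l); split => // /uk.
  have h3 : i.+1%:R * h * (x w l).2 <= (x w l).1.
    by rewrite leNgt; apply/negP => ?; apply: nl; left.
  have h4 : j.+1%:R * h * (x w l).2 <= 1 - (x w l).1.
    by rewrite leNgt; apply/negP => ?; apply: nl; right.
  split.
    apply: (@le_trans _ _ ((x w l).2 * (i.+1%:R * h * (x w k).2))).
      by rewrite ler_pM2l// ltW.
    by rewrite mulrA mulrC ler_pM2l// mulrC.
  apply: (@le_trans _ _ ((x w l).2 * (j.+1%:R * h * (x w k).2))).
    by rewrite ler_pM2l// ltW.
  by rewrite mulrA mulrC ler_pM2l// mulrC.
Qed.

End sandwich.

(** * Probability of a dominating point *)

Section dominating_probability.
Context {R : realType} (alpha : R) d (T : measurableType d) (P : probability T R).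
Context (x : T -> nat -> R * R).
Hypothesis alpha01 : 0 < alpha < 1.
Hypothesis xP : is_poisson_process P (intensity alpha) (fun w => sum_dirac (x w)).
Hypothesis xstrip : forall w k, strip (x w k).

Let G := [set w | exists k, dominating (x w) k].
Hypothesis mG : measurable G.

Let c := (1 - alpha)^-1.
Let c0 : 0 < c. Proof. by rewrite invr_gt0 subr_gt0; case/andP: alpha01. Qed.

(* With h^alpha = z and N h >= 1 / h, all the error terms are functions of z:
   (2 h)^alpha <= 2 z and exp (- c (N h)^alpha) <= exp (- c / z) <= z / c. *)
Let bounds z : 0 < z ->
  c^-1 * expR (- (c * (z + z))) * (1 - z / c) <= fine (P G) <=
  c^-1 * expR (c * (z + z)) + 2 * (z / c).
Proof.
move=> z0; have /andP[a0 a1] := alpha01.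
pose h := z `^ alpha^-1.
have h0 : 0 < h by rewrite powR_gt0.
have hz : h `^ alpha = z by rewrite -powRrM mulVf ?lt0r_neq0// powRr1// ltW.
have h2z : (2 * h) `^ alpha <= z + z.
  rewrite mulr2n mulrDl mul1r -{1 2}hz; apply: powRD_le;
    [by rewrite a0 ltW|exact: ltW|exact: ltW].
pose N := Num.Def.archi_bound (h^-1 / h).
have Nh : h^-1 <= N%:R * h.
  by rewrite -ler_pdivrMr// ltW// archi_boundP// divr_ge0// ltW// invr_gt0.
have tN : z^-1 <= (N%:R * h) `^ alpha.
  have -> : z^-1 = h^-1 `^ alpha.
    by rewrite -[h^-1]powR_inv1 ?(ltW h0)// -powRrM mulrC powRrM hz powR_inv1// ltW.
  apply: ge0_ler_powR => //; rewrite ?nnegrE; [exact: ltW|by rewrite invr_ge0 ltW|].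
  by rewrite mulr_ge0// ltW.
have eN : expR (- (c * (N%:R * h) `^ alpha)) <= z / c.
  rewrite expRN -[leRHS]invrK lef_pV2 ?posrE ?expR_gt0 ?invr_gt0 ?divr_gt0//.
  rewrite invfM invrK mulrC; apply: (@le_trans _ _ (c * (N%:R * h) `^ alpha)).
    by rewrite ler_pM2l.
  by apply: le_trans (expR_ge1Dx _); rewrite lerDr.
have fG : P G \is a fin_num by exact: fin_num_measure.
have := dominating_probability_le alpha01 xP xstrip mG N h0.
have := dominating_probability_ge alpha01 xP xstrip mG N h0.
rewrite -/c -(fineK fG) !lee_fin => lo up.
have c10 : 0 < c^-1 by rewrite invr_gt0.
apply/andP; split.
- apply: le_trans lo.
  have e1 : expR (- (c * (z + z))) <= expR (- (c * (2 * h) `^ alpha)).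
    by rewrite ler_expR lerN2 ler_pM2l.
  apply: (@le_trans _ _ (c^-1 * expR (- (c * (z + z))) *
      (1 - expR (- (c * (N%:R * h) `^ alpha))))).
    by rewrite ler_pM2l ?mulr_gt0 ?expR_gt0// lerD2l lerN2.
  apply: ler_wpM2r; last by rewrite ler_pM2l.
  rewrite subr_ge0 -expR0 ler_expR oppr_le0 mulr_ge0 ?powR_ge0//; exact: ltW.
- apply: (le_trans up); apply: lerD; last by rewrite ler_pM2l.
  by rewrite (ler_pM2l c10) ler_expR ler_pM2l.
Qed.

Lemma dominating_probability : P G = (1 - alpha)%:E.
Proof.
have fG : P G \is a fin_num by exact: fin_num_measure.
rewrite -(fineK fG); congr EFin; rewrite -[RHS]invrK -/c.
have id0 : z @[z --> (0 : R)^'+] --> (0 : R).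
  by apply: cvg_at_right_filter; exact: cvg_id.
have up : c^-1 * expR (c * (z + z)) + 2 * (z / c) @[z --> (0 : R)^'+] --> c^-1.
  rewrite [X in _ --> X](_ : _ = c^-1 * expR (c * (0 + 0)) + 2 * (0 / c)); last first.
    by rewrite addr0 mulr0 expR0 mulr1 mul0r mulr0 addr0.
  apply: cvgD; last by apply: cvgM; [exact: cvg_cst|apply: cvgM => //; exact: cvg_cst].
  apply: cvgM; first exact: cvg_cst.
  apply: continuous_cvg; first exact: continuous_expR.
  by apply: cvgM; [exact: cvg_cst|exact: cvgD].
have lo : c^-1 * expR (- (c * (z + z))) * (1 - z / c) @[z --> (0 : R)^'+] --> c^-1.
  rewrite [X in _ --> X](_ : _ = c^-1 * expR (- (c * (0 + 0))) * (1 - 0 / c)); last first.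
    by rewrite addr0 mulr0 oppr0 expR0 mulr1 mul0r subr0 mulr1.
  apply: cvgM; last first.
    by apply: cvgB; [exact: cvg_cst|apply: cvgM => //; exact: cvg_cst].
  apply: cvgM; first exact: cvg_cst.
  apply: continuous_cvg; first exact: continuous_expR.
  by apply: cvgN; apply: cvgM; [exact: cvg_cst|exact: cvgD].
apply/eqP; rewrite eq_le; apply/andP; split.
- apply: (cvgr_to_ge up); near=> z.
  have z0 : 0 < z by near: z; exact: nbhs_right_gt.
  by have /andP[] := bounds z0.
- apply: (cvgr_to_le lo); near=> z.
  have z0 : 0 < z by near: z; exact: nbhs_right_gt.
  by have /andP[] := bounds z0.
Unshelve. all: by end_near. Qed.

End dominating_probability.

Lemma probability_eq_outside d (T : measurableType d) (R : realType)
    (P : probability T R) (A B N : set T) : measurable A -> measurable B ->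
  measurable N -> P N = 0%E -> (forall w, ~ N w -> A w <-> B w) -> P A = P B.
Proof.
suff le A' B' : measurable A' -> measurable B' -> measurable N -> P N = 0%E ->
    (forall w, ~ N w -> A' w <-> B' w) -> (P A' <= P B')%E.
  move=> mA mB mN N0 AB; apply/eqP; rewrite eq_le !le// => w Nw.
  by split => /(AB w Nw).
move=> mA mB mN N0 AB; apply: (@le_trans _ _ (P (B' `|` N))).
  apply: le_measure; rewrite ?inE//; first exact: measurableU.
  by move=> w Aw; have [Nw|Nw] := pselect (N w); [right|left; apply/(AB w Nw)].
by apply: (le_trans (measureU2 _ _ _)) => //; rewrite [X in (_ + X)%E]N0 adde0.
Qed.

(** * Two linearity intervals *)

Theorem theorem1p9 (R : realType) (d : measure_display) (T : measurableType d)
    (P : probability T R) (alpha : R) (U V : nat -> {RV P >-> R}) :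
  0 < alpha < 1 ->
  (forall k w, strip (U k w, V k w)) ->
  is_poisson_process P (intensity alpha)
    (fun w => sum_dirac (fun k => (U k w, V k w))) ->
  let L := fun w : T =>
    nb_linearity_intervals
      (least_concave_majorant (fun k => (U k w, V k w))) in
  measurable [set w | L w = 2%:E] /\
  P [set w | L w = 2%:E] = (1 - alpha)%:E.
Proof.
move=> alpha01 UVstrip xP L.
pose x w k := (U k w, V k w).
have mU k : measurable_fun setT (U k) by [].
have mV k : measurable_fun setT (V k) by [].
have U01 k w : 0 <= U k w <= 1 by have [] := UVstrip k w; rewrite /= in_itv.
have xs w k : strip (x w k) by exact: UVstrip.
have mL : measurable [set w | L w = 2%:E].
  exact: (measurable_nb_linearity_intervals_eq2 mU mV U01).
split => //.
pose G := [set w | exists k, dominating (x w) k].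
have mG : measurable G.
  exact: (measurable_dominating mU mV).
rewrite -(dominating_probability alpha01 xP xs mG).
pose overfull (A : set (R * R)) := [set w | sum_dirac (x w) A = +oo%E :> \bar R].
pose sides : set (R * R) := [set p | p.1 = 0 \/ p.1 = 1].
have null0 A : finite_mass alpha A -> measurable (overfull A) /\ P (overfull A) = 0%E.
  move=> fA; have [mA _] := fA; split.
    have [mrho _ _] := xP.
    have := mrho A mA measurableT [set +oo%E] (emeasurable_set1 _).
    by rewrite setTI.
  exact: (infinite_probability xP mA (massE alpha01 fA)).
(* The null set: a point on a vertical side, or infinitely many points above
   some line through a foot. *)
pose N := ~` [set w | forall k, ~ sides (x w k)] `|`
  (\bigcup_n overfull (low_region n%:R 0) `|` \bigcup_n overfull (low_region 0 n%:R)).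
have mvoid : measurable [set w | forall k, ~ sides (x w k)].
  by apply: (measurable_void xP); exact: measurable_sides.
have fl (n m : nat) : finite_mass alpha (low_region n%:R m%:R).
  exact: finite_mass_low_region.
have mN : measurable N.
  apply: measurableU; first exact: measurableC.
  apply: measurableU; apply: bigcupT_measurable => n.
    by case: (null0 _ (fl n 0%N)).
  by case: (null0 _ (fl 0%N n)).
have N0 : P N = 0%E.
  have negl : P.-negligible N.
    apply: negligibleU.
      apply/negligibleP; first exact: measurableC.
      rewrite [LHS]probability_setC//.
      rewrite (void_probability xP (r := 0) measurable_sides)//; last exact: intensity_sides.
      by rewrite oppr0 expR0 subee.
    apply: negligibleU; apply: negligible_bigcup => n.
      by apply/negligibleP; case: (null0 _ (fl n 0%N)).
    by apply/negligibleP; case: (null0 _ (fl 0%N n)).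
  by apply/negligibleP.
apply: (probability_eq_outside mL mG mN N0) => w Nw.
have u01 k : 0 < (x w k).1 < 1.
  have /andP[u0 u1] := U01 k w.
  rewrite /= !lt_neqAle u0 u1 !andbT.
  apply/andP; split; apply/eqP => h; apply: Nw; left.
    by move=> /(_ k); apply; left.
  by move=> /(_ k); apply; right.
have fin0 (n : nat) : finite_set [set k | (x w k).1 < n%:R * (x w k).2].
  apply: (@sub_finite_set _ _ [set k | (low_region n%:R 0) (x w k)]).
    by move=> k; left.
  by apply: (@sum_dirac_neqy R) => h; apply: Nw; right; left; exists n.
have fin1 (n : nat) : finite_set [set k | 1 - (x w k).1 < n%:R * (x w k).2].
  apply: (@sub_finite_set _ _ [set k | (low_region 0 n%:R) (x w k)]).
    by move=> k; right.
  by apply: (@sum_dirac_neqy R) => h; apply: Nw; right; right; exists n.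
split=> [L2|[k dk]].
  apply: contrapT => nG.
  apply: (no_tent_apex_nb_linearity_intervals (xs w) u01 fin0 fin1) => //.
  by move=> [k [_ dk]]; apply: nG; exists k.
exact: (tent_nb_linearity_intervals (xs w) (conj (u01 k) dk)).
Qed.
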